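(* Over $\mathsf{PA}$ (in the language $\mathcal{L}_{PA}\cup\{T\}$ with $T$ an arbitrary unary predicate), $\mathsf{I}\Delta_0(T)$ implies $\mathsf{SeqOInd}$ and $\mathsf{SeqOInd}$ implies $\mathsf{SeqInd}$; moreover neither implication reverses: $\mathsf{PA}+\mathsf{SeqOInd}$ does not prove all of $\mathsf{I}\Delta_0(T)$, and $\mathsf{PA}+\mathsf{SeqInd}$ does not prove $\mathsf{SeqOInd}$.
   Context: $\mathsf{PA}$ is Peano Arithmetic in the language $\mathcal{L}_{PA}=\{S,+,\times,0\}$; here it is considered in the language $\mathcal{L}_{PA}\cup\{T\}$ with $T$ a fresh unary predicate, with the induction scheme of $\mathsf{PA}$ only for $\mathcal{L}_{PA}$-formulas, and coded finite sequences handled in the standard way. $\mathsf{I}\Delta_0(T)$ is the induction scheme for all $\Delta_0$-formulas of $\mathcal{L}_{PA}\cup\{T\}$. $\mathsf{SeqInd}$: for every coded finite sequence $s$, if $T(s_0)$ and $\forall i<\mathrm{lh}(s)-1\,(T(s_i)\to T(s_{i+1}))$, then $\forall j<\mathrm{lh}(s)\ T(s_j)$. $\mathsf{SeqOInd}$: for every coded finite sequence $s$, if for every $j<\mathrm{lh}(s)$ we have $(\forall i<j\ T(s_i))\to T(s_j)$, then $\forall l<\mathrm{lh}(s)\ T(s_l)$. *)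

(* Defs.v *)
From Stdlib Require Import List PeanoNat.
Import ListNotations.

(** First-order logic with equality over the language [{0, S, +, *}] extended by
    one unary predicate symbol [T]. Variables are de Bruijn indices; the
    primitive logical symbols are falsum, implication and the universal
    quantifier, the others being their classical abbreviations. *)

Inductive tm : Type :=
| Var (n : nat)
| Zero
| Succ (t : tm)
| Add (t u : tm)
| Mul (t u : tm).

Inductive fm : Type :=
| Fal
| Eq (t u : tm)
| Tr (t : tm)
| Imp (p q : fm)
| All (p : fm).

Definition Not (p : fm) : fm := Imp p Fal.
Definition And (p q : fm) : fm := Not (Imp p (Not q)).
Definition Ex (p : fm) : fm := Not (All (Not p)).

Fixpoint subst_tm (s : nat -> tm) (t : tm) : tm :=
  match t with
  | Var n => s n
  | Zero => Zero
  | Succ t => Succ (subst_tm s t)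
  | Add t u => Add (subst_tm s t) (subst_tm s u)
  | Mul t u => Mul (subst_tm s t) (subst_tm s u)
  end.

Definition shift (k : nat) : tm -> tm := subst_tm (fun n => Var (k + n)).

Definition up (s : nat -> tm) (n : nat) : tm :=
  match n with
  | 0 => Var 0
  | S n => shift 1 (s n)
  end.

Fixpoint subst (s : nat -> tm) (p : fm) : fm :=
  match p with
  | Fal => Fal
  | Eq t u => Eq (subst_tm s t) (subst_tm s u)
  | Tr t => Tr (subst_tm s t)
  | Imp p q => Imp (subst s p) (subst s q)
  | All p => All (subst (up s) p)
  end.

Definition shift_fm : fm -> fm := subst (fun n => Var (S n)).

Definition inst (t : tm) : fm -> fm :=
  subst (fun n => match n with 0 => t | S n => Var n end).

Inductive prv : list fm -> fm -> Prop :=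
| prv_ax G p : In p G -> prv G p
| prv_impI G p q : prv (p :: G) q -> prv G (Imp p q)
| prv_impE G p q : prv G (Imp p q) -> prv G p -> prv G q
| prv_raa G p : prv (Not p :: G) Fal -> prv G p
| prv_allI G p : prv (map shift_fm G) p -> prv G (All p)
| prv_allE G p t : prv G (All p) -> prv G (inst t p)
| prv_refl G t : prv G (Eq t t)
| prv_leibniz G p t u :
    prv G (Eq t u) -> prv G (inst t p) -> prv G (inst u p).

Definition theory : Type := fm -> Prop.

Definition proves (Th : theory) (p : fm) : Prop :=
  exists G : list fm, (forall q, In q G -> Th q) /\ prv G p.

Definition union (Th1 Th2 : theory) : theory := fun p => Th1 p \/ Th2 p.

Definition axiom (p : fm) : theory := fun q => q = p.

(** Universal closure: [bound p] exceeds every free variable of [p]. *)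

Fixpoint bound_tm (t : tm) : nat :=
  match t with
  | Var n => S n
  | Zero => 0
  | Succ t => bound_tm t
  | Add t u | Mul t u => Nat.max (bound_tm t) (bound_tm u)
  end.

Fixpoint bound (p : fm) : nat :=
  match p with
  | Fal => 0
  | Eq t u => Nat.max (bound_tm t) (bound_tm u)
  | Tr t => bound_tm t
  | Imp p q => Nat.max (bound p) (bound q)
  | All p => Nat.pred (bound p)
  end.

Definition closure (p : fm) : fm := Nat.iter (bound p) All p.

(** Induction on the variable [Var 0]; the other free variables of [p] are
    parameters. *)

Definition succ_inst : fm -> fm :=
  subst (fun n => match n with 0 => Succ (Var 0) | S n => Var (S n) end).

Definition induction (p : fm) : fm :=
  closure (Imp (inst Zero p) (Imp (All (Imp p (succ_inst p))) (All p))).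

Fixpoint T_free (p : fm) : Prop :=
  match p with
  | Fal | Eq _ _ => True
  | Tr _ => False
  | Imp p q => T_free p /\ T_free q
  | All p => T_free p
  end.

Inductive PA : theory :=
| PA_succ_neq_0 : PA (All (Not (Eq (Succ (Var 0)) Zero)))
| PA_succ_inj :
    PA (All (All (Imp (Eq (Succ (Var 1)) (Succ (Var 0))) (Eq (Var 1) (Var 0)))))
| PA_add_0 : PA (All (Eq (Add (Var 0) Zero) (Var 0)))
| PA_add_succ :
    PA (All (All (Eq (Add (Var 1) (Succ (Var 0))) (Succ (Add (Var 1) (Var 0))))))
| PA_mul_0 : PA (All (Eq (Mul (Var 0) Zero) Zero))
| PA_mul_succ :
    PA (All (All (Eq (Mul (Var 1) (Succ (Var 0))) (Add (Mul (Var 1) (Var 0)) (Var 1)))))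
| PA_induction p : T_free p -> PA (induction p).

(** [t < u] abbreviates [exists z, t + S z = u]. *)

Definition Lt (t u : tm) : fm :=
  Ex (Eq (Add (shift 1 t) (Succ (Var 0))) (shift 1 u)).

(** The bounding term lives outside the scope of the quantifier. *)

Definition AllLt (t : tm) (p : fm) : fm := All (Imp (Lt (Var 0) (shift 1 t)) p).
Definition ExLt (t : tm) (p : fm) : fm := Ex (And (Lt (Var 0) (shift 1 t)) p).

Inductive Delta0 : fm -> Prop :=
| Delta0_fal : Delta0 Fal
| Delta0_eq t u : Delta0 (Eq t u)
| Delta0_T t : Delta0 (Tr t)
| Delta0_imp p q : Delta0 p -> Delta0 q -> Delta0 (Imp p q)
| Delta0_all t p : Delta0 p -> Delta0 (AllLt t p)
| Delta0_ex t p : Delta0 p -> Delta0 (ExLt t p).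

Definition IDelta0T : theory := fun q => exists p, Delta0 p /\ q = induction p.

(** Coded finite sequences. [Pair x y z] is the graph of Cantor's pairing
    function, [2 z = (x + y) (x + y + 1) + 2 y]; [Beta c d i y] is the graph of
    Goedel's beta function, [y = c mod (1 + (i + 1) d)]. The number
    [s = <l, <c, d>>] codes the sequence of length [l] whose [i]-th entry is
    [beta(c, d, i)]; every number codes exactly one sequence, and a sequence has
    several codes. *)

Definition Pair (x y z : tm) : fm :=
  Eq (Add z z) (Add (Mul (Add x y) (Succ (Add x y))) (Add y y)).

Definition Code (s l c d : tm) : fm :=
  Ex (And (Pair (shift 1 l) (Var 0) (shift 1 s))
          (Pair (shift 1 c) (shift 1 d) (Var 0))).

Definition Beta (c d i y : tm) : fm :=
  And (Lt y (Succ (Mul (Succ i) d)))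
      (Ex (Eq (shift 1 c)
              (Add (Mul (Var 0) (shift 1 (Succ (Mul (Succ i) d)))) (shift 1 y)))).

Definition Lh (s l : tm) : fm :=
  Ex (Ex (Code (shift 2 s) (shift 2 l) (Var 1) (Var 0))).

Definition Entry (s i y : tm) : fm :=
  Ex (Ex (Ex (And (Code (shift 3 s) (Var 2) (Var 1) (Var 0))
                  (Beta (Var 1) (Var 0) (shift 3 i) (shift 3 y))))).

Definition T_entry (s i : tm) : fm :=
  Ex (And (Entry (shift 1 s) (shift 1 i) (Var 0)) (Tr (Var 0))).

(** In both sentences the two outer variables are [s] and [l = lh(s)];
    [i < lh(s) - 1] is written [S i < l]. *)

Definition SeqInd : fm :=
  All (All (Imp (Lh (Var 1) (Var 0))
    (Imp (T_entry (Var 1) Zero)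
      (Imp (All (Imp (Lt (Succ (Var 0)) (Var 1))
                  (Imp (T_entry (Var 2) (Var 0)) (T_entry (Var 2) (Succ (Var 0))))))
        (AllLt (Var 0) (T_entry (Var 2) (Var 0))))))).

Definition SeqOInd : fm :=
  All (All (Imp (Lh (Var 1) (Var 0))
    (Imp (AllLt (Var 0)
           (Imp (AllLt (Var 0) (T_entry (Var 3) (Var 0)))
                (T_entry (Var 2) (Var 0))))
      (AllLt (Var 0) (T_entry (Var 2) (Var 0)))))).

(* Main.v *)
From Stdlib Require Import List PeanoNat Lia Classical ClassicalEpsilon Cantor.
From Stdlib Require Import FunctionalExtensionality PropExtensionality ProofIrrelevance.
From Stdlib Require Import Ring Setoid Morphisms.
Require Import Defs.
Import ListNotations.

(** By completeness the two implications may be checked in models: [SeqOInd] follows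
    from [IDelta0T] because [T (s_i)] is bounded once the components [c], [d] of the
    code [s] are parameters, and [SeqInd] follows from [SeqOInd] on the same sequence.

    For the independence results, fix a countable nonstandard model of [PA] and build
    [T] by meeting countably many requirements, one for each sequence and index.
    For [SeqOInd] without [IDelta0T], conditions put a possibly infinite set into [T]
    but only finitely many elements out of it, all above a nonstandard number; then
    every sequence leaving [T] has a first entry outside [T], while [T] is nonempty
    without a least element. For [SeqInd] without [SeqOInd], conditions are finite and
    [T] contains the standard-index entries of an injective sequence [s0] of
    nonstandard length; along any sequence leaving [T], the least number principle for
    a definable approximation of [T] finds consecutive entries that can be put inside
    and outside [T], while the complement of [T] is made coinitial in the nonstandard
    indices of [s0]. *)

Definition scons {A : Type} (x : A) (r : nat -> A) (n : nat) : A :=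
  match n with 0 => x | S n => r n end.

(** * Substitution *)

Lemma subst_tm_ext (s r : nat -> tm) (t : tm) :
  (forall n, n < bound_tm t -> s n = r n) -> subst_tm s t = subst_tm r t.
Proof.
  induction t; simpl; intros H; auto; f_equal; auto with arith;
    (apply IHt1 || apply IHt2); intros; apply H; lia.
Qed.

Lemma up_ext (s r : nat -> tm) (b : nat) :
  (forall n, n < Nat.pred b -> s n = r n) -> forall n, n < b -> up s n = up r n.
Proof. intros H [|n] Hn; simpl; auto. rewrite H; auto. lia. Qed.

Lemma subst_ext (p : fm) : forall s r : nat -> tm,
  (forall n, n < bound p -> s n = r n) -> subst s p = subst r p.
Proof.
  induction p; simpl; intros s r H; auto.
  - f_equal; apply subst_tm_ext; intros; apply H; lia.
  - f_equal; apply subst_tm_ext; auto.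
  - f_equal; [apply IHp1 | apply IHp2]; intros; apply H; lia.
  - f_equal; apply IHp; apply up_ext; auto.
Qed.

Lemma subst_tm_comp (s r : nat -> tm) (t : tm) :
  subst_tm s (subst_tm r t) = subst_tm (fun n => subst_tm s (r n)) t.
Proof. induction t; simpl; congruence. Qed.

Lemma up_comp (s r : nat -> tm) (n : nat) :
  subst_tm (up s) (up r n) = up (fun k => subst_tm s (r k)) n.
Proof.
  destruct n; simpl; auto. unfold shift. rewrite !subst_tm_comp. reflexivity.
Qed.

Lemma subst_comp (p : fm) : forall s r : nat -> tm,
  subst s (subst r p) = subst (fun n => subst_tm s (r n)) p.
Proof.
  induction p; simpl; intros; rewrite ?subst_tm_comp; auto.
  - rewrite IHp1, IHp2; auto.
  - f_equal. rewrite IHp. apply subst_ext. intros; apply up_comp.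
Qed.

Lemma subst_tm_id (t : tm) : subst_tm Var t = t.
Proof. induction t; simpl; congruence. Qed.

Lemma subst_id (p : fm) : subst Var p = p.
Proof.
  induction p; simpl; rewrite ?subst_tm_id; auto; try congruence.
  f_equal. rewrite <- IHp at 2. apply subst_ext. intros [|n] _; reflexivity.
Qed.

Lemma inst_scons (t : tm) (p : fm) : inst t p = subst (scons t Var) p.
Proof. apply subst_ext. intros [|n] _; reflexivity. Qed.

Lemma inst_up (t : tm) (s : nat -> tm) (p : fm) :
  inst t (subst (up s) p) = subst (scons t s) p.
Proof.
  unfold inst. rewrite subst_comp. apply subst_ext. intros [|n] _; simpl; auto.
  unfold shift. rewrite subst_tm_comp. apply subst_tm_id.
Qed.

Lemma inst_shift_tm (t u : tm) :
  subst_tm (fun n => match n with 0 => t | S n => Var n end) (shift 1 u) = u.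
Proof. unfold shift. rewrite subst_tm_comp. apply subst_tm_id. Qed.

Lemma subst_inst (s : nat -> tm) (t : tm) (p : fm) :
  subst s (inst t p) = inst (subst_tm s t) (subst (up s) p).
Proof.
  rewrite inst_up, inst_scons, subst_comp. apply subst_ext.
  intros [|n] _; reflexivity.
Qed.

Lemma T_free_subst (p : fm) : forall s, T_free p -> T_free (subst s p).
Proof. induction p; simpl; firstorder. Qed.

(** * Derivability *)

Lemma prv_weak (G : list fm) (p : fm) :
  prv G p -> forall H, incl G H -> prv H p.
Proof.
  induction 1; intros K HK.
  - apply prv_ax; auto.
  - apply prv_impI, IHprv. apply incl_cons; [left; auto|apply incl_tl; auto].
  - eapply prv_impE; eauto.
  - apply prv_raa, IHprv. apply incl_cons; [left; auto|apply incl_tl; auto].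
  - apply prv_allI, IHprv, incl_map; auto.
  - apply prv_allE; auto.
  - apply prv_refl.
  - eapply prv_leibniz; eauto.
Qed.

Lemma prv_subst (G : list fm) (p : fm) :
  prv G p -> forall s, prv (map (subst s) G) (subst s p).
Proof.
  induction 1; intros s; simpl in *.
  - apply prv_ax, in_map; auto.
  - apply prv_impI, IHprv.
  - eapply prv_impE; eauto.
  - apply prv_raa, IHprv.
  - apply prv_allI. specialize (IHprv (up s)).
    rewrite map_map in *. erewrite map_ext; [apply IHprv|].
    intros q. unfold shift_fm. rewrite !subst_comp. apply subst_ext. auto.
  - rewrite subst_inst. apply prv_allE; auto.
  - apply prv_refl.
  - rewrite subst_inst. eapply prv_leibniz; [apply IHprv1|].
    rewrite <- subst_inst. auto.
Qed.

(** The variable [k] is free neither in [G] nor in [All p]. The renaming that sends [k] to [0] and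
    shifts every other variable therefore turns the instance back into [p], and acts on [G] as the
    plain shift that [prv_allI] asks for. *)
Lemma prv_generalize (G : list fm) (p : fm) (k : nat) :
  (forall q, In q G -> bound q <= k) -> bound (All p) <= k ->
  prv G (inst (Var k) p) -> prv G (All p).
Proof.
  intros HG Hp H. apply prv_allI. simpl in Hp.
  apply prv_subst with (s := fun n => if n =? k then Var 0 else Var (S n)) in H.
  rewrite map_ext_in with (g := shift_fm) in H.
  - rewrite inst_scons, subst_comp in H.
    rewrite subst_ext with (r := Var), subst_id in H; auto.
    intros [|n] Hn; simpl.
    + rewrite Nat.eqb_refl; auto.
    + destruct (Nat.eqb_spec n k); auto. lia.
  - intros q Hq. apply subst_ext. intros n Hn.
    apply HG in Hq. destruct (Nat.eqb_spec n k); auto. lia.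
Qed.

Lemma proves_mono (Th Th' : theory) (p : fm) :
  (forall q, Th q -> Th' q) -> proves Th p -> proves Th' p.
Proof. intros H [G [HG Hp]]. exists G; auto. Qed.

Lemma proves_ax (Th : theory) (p : fm) : Th p -> proves Th p.
Proof.
  intros H. exists [p]. split; [|apply prv_ax; left; auto].
  intros q [<-|[]]; auto.
Qed.

Lemma proves_prv (Th : theory) (G : list fm) (p : fm) :
  (forall q, In q G -> proves Th q) -> prv G p -> proves Th p.
Proof.
  revert p. induction G as [|q G IH]; intros p HG Hp.
  - exists []; split; auto. intros q [].
  - destruct (IH (Imp q p)) as [H [H1 H2]].
    + intros; apply HG; right; auto.
    + apply prv_impI; auto.
    + destruct (HG q) as [K [K1 K2]]; [left; auto|].
      exists (H ++ K). split.
      * intros r Hr. apply in_app_or in Hr as [?|?]; auto.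
      * eapply prv_impE; eapply prv_weak; eauto; intros r Hr;
          apply in_or_app; auto.
Qed.

Lemma proves_imp (Th : theory) (p q : fm) :
  proves (union Th (axiom p)) q -> proves Th (Imp p q).
Proof.
  intros [G [HG Hq]].
  (* Deduction theorem: the axioms used are separated into axioms of [Th] and copies of [p], and the
     latter are discharged together. *)
  assert (HH : exists H, (forall r, In r H -> Th r) /\ incl G (p :: H)).
  { clear Hq. induction G as [|r G IH].
    - exists []. split; [intros r []|intros r []].
    - destruct IH as [H [H1 H2]]; [intros; apply HG; right; auto|].
      destruct (HG r (or_introl eq_refl)) as [Hr|Hr].
      + exists (r :: H). split.
        * intros u [<-|Hu]; auto.
        * intros u [<-|Hu]; [right; left; auto|].
          destruct (H2 u Hu) as [<-|]; [left|right; right]; auto.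
      + exists H. split; auto. apply incl_cons; auto. left; auto. }
  destruct HH as [H [H1 H2]]. exists H. split; auto.
  apply prv_impI. eapply prv_weak; eauto.
Qed.

Lemma proves_raa (Th : theory) (p : fm) :
  proves (union Th (axiom (Not p))) Fal -> proves Th p.
Proof.
  intros H. apply proves_imp in H. eapply proves_prv with (G := [Imp (Not p) Fal]).
  - intros q [<-|[]]; auto.
  - apply prv_raa. eapply prv_impE; apply prv_ax; simpl; auto.
Qed.

(** * Semantics *)

Record structure := {
  dom :> Type;
  zero : dom;
  succ : dom -> dom;
  add : dom -> dom -> dom;
  mul : dom -> dom -> dom
}.
Arguments zero {_}.
Arguments succ {_} _.
Arguments add {_} _ _.
Arguments mul {_} _ _.

Fixpoint eval {M : structure} (r : nat -> M) (t : tm) : M :=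
  match t with
  | Var n => r n
  | Zero => zero
  | Succ t => succ (eval r t)
  | Add t u => add (eval r t) (eval r u)
  | Mul t u => mul (eval r t) (eval r u)
  end.

Fixpoint sat {M : structure} (T : M -> Prop) (r : nat -> M) (p : fm) : Prop :=
  match p with
  | Fal => False
  | Eq t u => eval r t = eval r u
  | Tr t => T (eval r t)
  | Imp p q => sat T r p -> sat T r q
  | All p => forall x, sat T (scons x r) p
  end.

Section Semantics.

Context {M : structure}.
Implicit Types (T : M -> Prop) (r : nat -> M).

Lemma eval_ext r r' (t : tm) :
  (forall n, n < bound_tm t -> r n = r' n) -> eval r t = eval r' t.
Proof.
  induction t; simpl; intros H; auto; f_equal; auto with arith;
    (apply IHt1 || apply IHt2); intros; apply H; lia.
Qed.

Lemma sat_ext T (p : fm) : forall r r',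
  (forall n, n < bound p -> r n = r' n) -> (sat T r p <-> sat T r' p).
Proof.
  induction p; simpl; intros r r' H.
  - tauto.
  - rewrite (eval_ext r r' t), (eval_ext r r' u); [tauto| |]; intros; apply H; lia.
  - rewrite (eval_ext r r'); tauto.
  - rewrite (IHp1 r r'), (IHp2 r r'); [tauto| |]; intros; apply H; lia.
  - split; intros Hx x; specialize (Hx x); eapply IHp; try eassumption;
      intros [|n] Hn; simpl; auto; [symmetry|]; apply H; lia.
Qed.

Lemma eval_subst r (s : nat -> tm) (t : tm) :
  eval r (subst_tm s t) = eval (fun n => eval r (s n)) t.
Proof. induction t; simpl; congruence. Qed.

Lemma eval_shift1 (x : M) r (t : tm) : eval (scons x r) (shift 1 t) = eval r t.
Proof. unfold shift. rewrite eval_subst. reflexivity. Qed.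

Lemma sat_subst T (p : fm) : forall (s : nat -> tm) r,
  sat T r (subst s p) <-> sat T (fun n => eval r (s n)) p.
Proof.
  induction p; simpl; intros s r; rewrite ?eval_subst; try tauto.
  - rewrite IHp1, IHp2; tauto.
  - split; intros H x; specialize (H x); rewrite IHp in *;
      (eapply sat_ext; [|exact H]); intros [|n] _; simpl; auto;
      rewrite eval_shift1; auto.
Qed.

Lemma sat_inst T (t : tm) (p : fm) r :
  sat T r (inst t p) <-> sat T (scons (eval r t) r) p.
Proof.
  unfold inst. rewrite sat_subst. apply sat_ext. intros [|n] _; reflexivity.
Qed.

Lemma sat_closed T (p : fm) r r' : bound p = 0 -> sat T r p -> sat T r' p.
Proof. intros H. apply sat_ext. intros n Hn. lia. Qed.

Lemma sat_not T r (p : fm) : sat T r (Not p) <-> ~ sat T r p.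
Proof. reflexivity. Qed.

Lemma sat_and T r (p q : fm) : sat T r (And p q) <-> sat T r p /\ sat T r q.
Proof. simpl. tauto. Qed.

Lemma sat_ex T r (p : fm) : sat T r (Ex p) <-> exists x, sat T (scons x r) p.
Proof.
  simpl. split.
  - intros H. apply NNPP. intros N. apply H. intros x Hx. eauto.
  - intros [x Hx] H. exact (H x Hx).
Qed.

Lemma sat_T_free T T' (p : fm) : T_free p -> forall r, sat T r p <-> sat T' r p.
Proof.
  induction p; simpl; intros H r; try tauto.
  - rewrite IHp1, IHp2; tauto.
  - split; intros Hx x; apply IHp; auto.
Qed.

Lemma soundness T (G : list fm) (p : fm) :
  prv G p -> forall r, (forall q, In q G -> sat T r q) -> sat T r p.
Proof.
  induction 1; intros r HG.
  - auto.
  - simpl. intros Hp. apply IHprv. intros u [<-|Hu]; auto.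
  - apply (IHprv1 r HG), IHprv2; auto.
  - apply NNPP. intros N. apply (IHprv r). intros u [<-|Hu]; auto.
  - intros x. apply IHprv. intros u Hu. apply in_map_iff in Hu as [v [<- Hv]].
    unfold shift_fm. rewrite sat_subst. apply HG in Hv.
    eapply sat_ext; [|exact Hv]. intros n _. reflexivity.
  - rewrite sat_inst. apply (IHprv r HG).
  - reflexivity.
  - rewrite sat_inst in *. apply IHprv2 in HG as Hp. apply IHprv1 in HG.
    simpl in HG. rewrite <- HG. apply sat_inst; auto.
Qed.

Lemma iter_all_elim T (p : fm) (n : nat) :
  (forall r, sat T r (Nat.iter n All p)) -> forall r, sat T r p.
Proof.
  induction n; simpl; auto. intros H. apply IHn. intros r.
  eapply sat_ext; [|apply (H (fun n => r (S n)) (r 0))].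
  intros [|k] _; reflexivity.
Qed.

Lemma bound_iter_all (p : fm) (n : nat) : bound (Nat.iter n All p) = bound p - n.
Proof. induction n; simpl; lia. Qed.

Lemma bound_closure (p : fm) : bound (closure p) = 0.
Proof. unfold closure. rewrite bound_iter_all. lia. Qed.

Lemma sat_closure T r (p : fm) : sat T r (closure p) <-> forall r', sat T r' p.
Proof.
  split; intros H.
  - apply iter_all_elim with (n := bound p). intros r'.
    eapply sat_closed; [apply bound_closure|exact H].
  - unfold closure. revert r. induction (bound p); simpl; auto.
Qed.

Lemma sat_induction T r (p : fm) :
  sat T r (induction p) <->
  forall r', sat T (scons zero r') p ->
    (forall x, sat T (scons x r') p -> sat T (scons (succ x) r') p) ->
    forall x, sat T (scons x r') p.
Proof.
  unfold induction. rewrite sat_closure.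
  assert (E : forall r x, sat T (scons x r) (succ_inst p) <-> sat T (scons (succ x) r) p).
  { intros r' x. unfold succ_inst. rewrite sat_subst. apply sat_ext.
    intros [|n] _; reflexivity. }
  split; intros H r'; specialize (H r'); simpl in *; rewrite sat_inst in *;
    intros H0 HS; apply H; auto; intros x; specialize (HS x); rewrite E in *; auto.
Qed.

End Semantics.

(** * Completeness *)

(** The fuel [f] makes the recursion structural, with [Zero] as the default when it runs out. A code
    is a Cantor pair of a constructor tag and its data; only surjectivity is wanted, so large tags
    all fall to the last constructor. *)
Fixpoint decode_tm (f n : nat) : tm :=
  match f with
  | 0 => Zero
  | S f =>
    let (k, m) := of_nat n in
    let (a, b) := of_nat m in
    match k with
    | 0 => Var m
    | 1 => Zero
    | 2 => Succ (decode_tm f m)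
    | 3 => Add (decode_tm f a) (decode_tm f b)
    | _ => Mul (decode_tm f a) (decode_tm f b)
    end
  end.

Fixpoint decode_fm (f n : nat) : fm :=
  match f with
  | 0 => Fal
  | S f =>
    let (k, m) := of_nat n in
    let (a, b) := of_nat m in
    match k with
    | 0 => Fal
    | 1 => Eq (decode_tm f a) (decode_tm f b)
    | 2 => Tr (decode_tm f m)
    | 3 => Imp (decode_fm f a) (decode_fm f b)
    | _ => All (decode_fm f m)
    end
  end.

Ltac decode_with f n :=
  exists (S f), n; let e := fresh in let He := fresh in
  intros e He; destruct e as [|e]; [lia|]; cbn [decode_tm decode_fm];
  repeat (rewrite cancel_of_to; cbn [decode_tm decode_fm]).

Lemma decode_tm_surj (t : tm) : exists f n, forall e, f <= e -> decode_tm e n = t.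
Proof.
  induction t as [v| |t [f [n H]]|t [f [n H]] u [g [m K]]|t [f [n H]] u [g [m K]]].
  - decode_with 0 (to_nat (0, v)). destruct (of_nat v); auto.
  - decode_with 0 (to_nat (1, 0)). auto.
  - decode_with f (to_nat (2, n)). destruct (of_nat n). rewrite H; auto; lia.
  - decode_with (f + g) (to_nat (3, to_nat (n, m))). rewrite H, K; auto; lia.
  - decode_with (f + g) (to_nat (4, to_nat (n, m))). rewrite H, K; auto; lia.
Qed.

Lemma decode_fm_surj (p : fm) : exists f n, forall e, f <= e -> decode_fm e n = p.
Proof.
  induction p as [|t u|t|p [f [n H]] q [g [m K]]|p [f [n H]]].
  - decode_with 0 (to_nat (0, 0)). auto.
  - destruct (decode_tm_surj t) as [f [n H]], (decode_tm_surj u) as [g [m K]].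
    decode_with (f + g) (to_nat (1, to_nat (n, m))). rewrite H, K; auto; lia.
  - destruct (decode_tm_surj t) as [f [n H]].
    decode_with f (to_nat (2, n)). destruct (of_nat n). rewrite H; auto; lia.
  - decode_with (f + g) (to_nat (3, to_nat (n, m))). rewrite H, K; auto; lia.
  - decode_with f (to_nat (4, n)). destruct (of_nat n). rewrite H; auto; lia.
Qed.

Definition countable (A : Type) : Prop := exists e : nat -> A, forall x, exists n, e n = x.

Lemma countable_of_decoding (A : Type) (dec : nat -> nat -> A) :
  (forall x, exists f n, forall e, f <= e -> dec e n = x) -> countable A.
Proof.
  intros H. exists (fun n => dec (fst (of_nat n)) (snd (of_nat n))). intros x.
  destruct (H x) as [f [n K]]. exists (to_nat (f, n)).
  rewrite cancel_of_to. simpl. auto.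
Qed.

(** * The term model of a maximal consistent Henkin theory *)

Section Henkin.

Variable G : theory.
Hypothesis G_prv : forall L p, (forall q, In q L -> G q) -> prv L p -> G p.
Hypothesis G_con : ~ G Fal.
Hypothesis G_max : forall p, G p \/ G (Not p).
Hypothesis G_henkin : forall p, (forall t, G (inst t p)) -> G (All p).

Let teq (t u : tm) : Prop := G (Eq t u).

Lemma G_leibniz (p : fm) (t u : tm) : teq t u -> G (inst t p) -> G (inst u p).
Proof.
  intros E H. apply (G_prv [Eq t u; inst t p]).
  - intros q [<-|[<-|[]]]; auto.
  - apply prv_leibniz with t; apply prv_ax; simpl; auto.
Qed.

Lemma teq_refl (t : tm) : teq t t.
Proof. apply (G_prv []); [intros q []|apply prv_refl]. Qed.

(** Leibniz is applied to an equation in [Var 0] whose fixed side is shifted; [inst_shift_tm] undoes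
    the shift after instantiation. Transitivity and congruence follow the same pattern. *)
Lemma teq_sym (t u : tm) : teq t u -> teq u t.
Proof.
  intros E. pose proof (G_leibniz (Eq (Var 0) (shift 1 t)) t u E) as H.
  unfold inst in H; simpl in H. rewrite inst_shift_tm in H.
  rewrite inst_shift_tm in H. apply H, teq_refl.
Qed.

Lemma teq_trans (t u v : tm) : teq t u -> teq u v -> teq t v.
Proof.
  intros E F. pose proof (G_leibniz (Eq (shift 1 t) (Var 0)) u v F) as H.
  unfold inst in H; simpl in H. rewrite !inst_shift_tm in H. exact (H E).
Qed.

Lemma teq_cong (c : tm) (t u : tm) : teq t u ->
  teq (subst_tm (scons t Var) c) (subst_tm (scons u Var) c).
Proof.
  intros E.
  pose proof (G_leibniz (Eq (shift 1 (subst_tm (scons t Var) c)) c) t u E) as H.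
  unfold inst in H; simpl in H. rewrite !inst_shift_tm in H. apply H, teq_refl.
Qed.

Lemma teq_succ (t u : tm) : teq t u -> teq (Succ t) (Succ u).
Proof. apply (teq_cong (Succ (Var 0))). Qed.

Lemma shift1_scons (t u : tm) : subst_tm (scons t Var) (shift 1 u) = u.
Proof. unfold shift. rewrite subst_tm_comp. apply subst_tm_id. Qed.

Lemma teq_add (t u t' u' : tm) : teq t t' -> teq u u' -> teq (Add t u) (Add t' u').
Proof.
  intros E F. apply teq_trans with (Add t' u).
  - pose proof (teq_cong (Add (Var 0) (shift 1 u)) _ _ E) as H. simpl in H.
    rewrite !shift1_scons in H. exact H.
  - pose proof (teq_cong (Add (shift 1 t') (Var 0)) _ _ F) as H. simpl in H.
    rewrite !shift1_scons in H. exact H.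
Qed.

Lemma teq_mul (t u t' u' : tm) : teq t t' -> teq u u' -> teq (Mul t u) (Mul t' u').
Proof.
  intros E F. apply teq_trans with (Mul t' u).
  - pose proof (teq_cong (Mul (Var 0) (shift 1 u)) _ _ E) as H. simpl in H.
    rewrite !shift1_scons in H. exact H.
  - pose proof (teq_cong (Mul (shift 1 t') (Var 0)) _ _ F) as H. simpl in H.
    rewrite !shift1_scons in H. exact H.
Qed.

(** [epsilon] is applied to the predicate [teq t], which extensionality makes identical for provably
    equal terms. Each class thus has one canonical member, and the quotient becomes the subtype of
    terms fixed by [rep]. *)
Let rep (t : tm) : tm := epsilon (inhabits Zero) (teq t).

Lemma teq_rep (t : tm) : teq t (rep t).
Proof. unfold rep. apply epsilon_spec. exists t. apply teq_refl. Qed.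

Lemma rep_eq (t u : tm) : teq t u -> rep t = rep u.
Proof.
  intros E. unfold rep. f_equal. extensionality v. apply propositional_extensionality.
  split; intros H; eapply teq_trans; eauto using teq_sym.
Qed.

Let D : Type := {t : tm | rep t = t}.

Let cls (t : tm) : D := exist _ (rep t) (rep_eq _ _ (teq_sym _ _ (teq_rep t))).

Lemma cls_eq (t u : tm) : cls t = cls u <-> teq t u.
Proof.
  split; intros H.
  - assert (E : rep t = rep u) by exact (f_equal (@proj1_sig _ _) H).
    eapply teq_trans; [apply teq_rep|]. rewrite E. apply teq_sym, teq_rep.
  - apply eq_sig_hprop; [intros; apply proof_irrelevance|]. apply rep_eq; auto.
Qed.

Lemma cls_val (x : D) : cls (proj1_sig x) = x.
Proof.
  apply eq_sig_hprop; [intros; apply proof_irrelevance|]. apply (proj2_sig x).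
Qed.

Lemma teq_val (t : tm) : teq (proj1_sig (cls t)) t.
Proof. apply teq_sym, teq_rep. Qed.

Let term_model : structure := {|
  dom := D;
  zero := cls Zero;
  succ x := cls (Succ (proj1_sig x));
  add x y := cls (Add (proj1_sig x) (proj1_sig y));
  mul x y := cls (Mul (proj1_sig x) (proj1_sig y))
|}.

Let term_T (x : term_model) : Prop := G (Tr (proj1_sig (x : D))).

Lemma eval_term_model (s : nat -> tm) (t : tm) :
  @eval term_model (fun n => cls (s n)) t = cls (subst_tm s t).
Proof.
  induction t; cbn [eval subst_tm]; auto; rewrite ?IHt, ?IHt1, ?IHt2; apply cls_eq;
    auto using teq_succ, teq_add, teq_mul, teq_val.
Qed.

(** Truth lemma, by induction on [p] for all substitutions at once. Implication rests on maximality;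
    the universal quantifier rests on the Henkin property and on every element being the class of a
    term. *)
Lemma sat_term_model (p : fm) : forall s : nat -> tm,
  @sat term_model term_T (fun n => cls (s n)) p <-> G (subst s p).
Proof.
  induction p; intros s; cbn [sat subst].
  - tauto.
  - rewrite !eval_term_model. apply cls_eq.
  - rewrite eval_term_model. unfold term_T. split; apply (G_leibniz (Tr (Var 0))).
    + apply teq_val.
    + apply teq_rep.
  - rewrite IHp1, IHp2. split.
    + intros H. destruct (G_max (subst s p1)) as [H1|H1].
      * apply (G_prv [subst s p2]); [intros q [<-|[]]; auto|].
        apply prv_impI, prv_ax. simpl; auto.
      * apply (G_prv [Not (subst s p1)]); [intros q [<-|[]]; auto|].
        apply prv_impI, prv_raa.
        eapply prv_impE; apply prv_ax; simpl; [right; right; left; reflexivity|auto].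
    + intros H H1. apply (G_prv [Imp (subst s p1) (subst s p2); subst s p1]).
      * intros q [<-|[<-|[]]]; auto.
      * eapply prv_impE; apply prv_ax; simpl; auto.
  - assert (E : forall t, @sat term_model term_T (scons (cls t) (fun n => cls (s n))) p
                  <-> G (inst t (subst (up s) p))).
    { intros t. rewrite inst_up, <- IHp. apply sat_ext. intros [|n] _; reflexivity. }
    split.
    + intros H. apply G_henkin. intros t. apply E, H.
    + intros H x. rewrite <- (cls_val x). apply E.
      apply (G_prv [All (subst (up s) p)]); [intros q [<-|[]]; auto|].
      apply prv_allE, prv_ax. simpl; auto.
Qed.

Lemma henkin_model : exists (M : structure) (T : M -> Prop) (r : nat -> M),
  countable M /\ forall p, G p -> sat T r p.
Proof.
  exists term_model, term_T, (fun n => cls (Var n)). split.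
  - destruct (countable_of_decoding _ _ decode_tm_surj) as [e He].
    exists (fun n => cls (e n)). intros x. destruct (He (proj1_sig (x : D))) as [n Hn].
    exists n. rewrite Hn. apply cls_val.
  - intros p Hp. apply sat_term_model. rewrite subst_id. auto.
Qed.

End Henkin.

(** * Extension of a consistent theory to a maximal one with witnesses *)

Section Lindenbaum.

Variable Th : theory.
Variable N : nat.
Hypothesis Th_bound : forall p, Th p -> bound p <= N.
Hypothesis Th_con : ~ proves Th Fal.

Let ext (L : list fm) : theory := union Th (fun q => In q L).

(** [N] bounds the variables of all of [Th] and [L] is finite, so the variable with this index is
    free in no formula of the current stage. *)
Let fresh (L : list fm) : nat := Nat.max N (list_max (map bound L)).

(** The matched shape is [Not (All q)] unfolded: such a formula enters together with a
    counterexample at the variable [k]. *)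
Let witness (p : fm) (k : nat) : list fm :=
  match p with
  | Imp (All q) Fal => [Not (inst (Var k) q)]
  | _ => []
  end.

Let step (L : list fm) (p : fm) : list fm :=
  if excluded_middle_informative (proves (ext (p :: L)) Fal) then L
  else witness p (fresh (p :: L)) ++ p :: L.

Lemma fresh_bound (L : list fm) (q : fm) : ext L q -> bound q <= fresh L.
Proof.
  unfold fresh. intros [H|H].
  - apply Th_bound in H. lia.
  - assert (bound q <= list_max (map bound L)); [|lia].
    assert (F : Forall (fun k => k <= list_max (map bound L)) (map bound L))
      by (apply list_max_le; lia).
    rewrite Forall_forall in F. apply F, in_map; auto.
Qed.

(** If the added counterexample were inconsistent with the stage, the stage would prove [q] at a
    variable free nowhere in it, hence [All q], although [Not (All q)] belongs to [L]. *)
Lemma witness_con (L : list fm) (p : fm) :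
  In p L -> ~ proves (ext L) Fal -> ~ proves (ext (witness p (fresh L) ++ L)) Fal.
Proof.
  intros Hp HL.
  destruct p as [| | |[| | | |q] [| | | |]|]; try exact HL.
  change (witness (Imp (All q) Fal) (fresh L)) with [Not (inst (Var (fresh L)) q)].
  intros H.
  assert (K : proves (ext L) (inst (Var (fresh L)) q)).
  { apply proves_raa. eapply proves_mono; [|exact H].
    intros r [Hr|[<-|Hr]]; [left; left|right|left; right]; auto; reflexivity. }
  destruct K as [G [G1 G2]]. apply HL.
  apply proves_prv with [All q; Not (All q)].
  - intros r [<-|[<-|[]]].
    + exists G. split; auto. apply prv_generalize with (fresh L); auto.
      * intros r Hr. apply fresh_bound; auto.
      * assert (E : bound (Imp (All q) Fal) <= fresh L) by (apply fresh_bound; right; auto).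
        simpl in *. lia.
    + apply proves_ax. right; auto.
  - eapply prv_impE; apply prv_ax; simpl; [right; left; reflexivity|auto].
Qed.

Lemma step_con (L : list fm) (p : fm) :
  ~ proves (ext L) Fal -> ~ proves (ext (step L p)) Fal.
Proof.
  unfold step. destruct excluded_middle_informative as [H|H]; auto.
  intros _. apply witness_con; simpl; auto.
Qed.

Lemma step_incl (L : list fm) (p : fm) : incl L (step L p).
Proof.
  unfold step. destruct excluded_middle_informative; [apply incl_refl|].
  intros q Hq. apply in_or_app. right; right; auto.
Qed.

Variable e : nat -> fm.
Hypothesis e_surj : forall p, exists n, e n = p.

Fixpoint chain (n : nat) : list fm :=
  match n with 0 => [] | S n => step (chain n) (e n) end.

Lemma chain_con (n : nat) : ~ proves (ext (chain n)) Fal.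
Proof.
  induction n; simpl; [|apply step_con; auto]. intros H. apply Th_con.
  eapply proves_mono; [|exact H]. intros q [Hq|[]]; auto.
Qed.

Lemma chain_incl (n m : nat) : n <= m -> incl (chain n) (chain m).
Proof.
  induction 1; [apply incl_refl|]. eapply incl_tran; [exact IHle|].
  apply step_incl.
Qed.

Let lim (p : fm) : Prop := exists n, proves (ext (chain n)) p.

Lemma ext_chain_mono (n m : nat) (p : fm) :
  n <= m -> proves (ext (chain n)) p -> proves (ext (chain m)) p.
Proof.
  intros H. apply proves_mono. intros q [Hq|Hq]; [left|right]; auto.
  eapply chain_incl; eauto.
Qed.

Lemma lim_prv (L : list fm) (p : fm) : (forall q, In q L -> lim q) -> prv L p -> lim p.
Proof.
  intros HL Hp.
  assert (exists n, forall q, In q L -> proves (ext (chain n)) q) as [n Hn].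
  { clear Hp. induction L as [|q L IH]; [exists 0; intros q []|].
    destruct IH as [n Hn]; [intros; apply HL; right; auto|].
    destruct (HL q (or_introl eq_refl)) as [m Hm]. exists (Nat.max n m).
    intros r [<-|Hr]; (eapply ext_chain_mono; [|eauto]); lia. }
  exists n. eapply proves_prv; eauto.
Qed.

Lemma lim_con : ~ lim Fal.
Proof. intros [n H]. exact (chain_con n H). Qed.

Lemma lim_max (p : fm) : lim p \/ lim (Not p).
Proof.
  destruct (e_surj p) as [n Hn].
  destruct (classic (proves (ext (p :: chain n)) Fal)) as [H|H].
  - right. exists n. apply proves_imp. eapply proves_mono; [|exact H].
    intros q [Hq|[<-|Hq]]; [left; left|right|left; right]; auto; reflexivity.
  - left. exists (S n). apply proves_ax. right. simpl. rewrite Hn. unfold step.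
    destruct excluded_middle_informative; [tauto|]. apply in_or_app. right; left; auto.
Qed.

Lemma lim_henkin (p : fm) : (forall t, lim (inst t p)) -> lim (All p).
Proof.
  intros H. destruct (lim_max (All p)) as [|K]; auto. exfalso.
  destruct (e_surj (Not (All p))) as [n Hn]. apply lim_con.
  (* When its turn comes, [Not (All p)] cannot be rejected, since its double negation would then
     hold in the limit; so its witness was added at that stage. *)
  assert (W : exists k, lim (Not (inst (Var k) p))).
  { exists (fresh (Not (All p) :: chain n)). exists (S n). apply proves_ax. right.
    simpl. rewrite Hn. unfold step. destruct excluded_middle_informative as [C|C].
    - exfalso. apply lim_con. apply (lim_prv [Not (All p); Not (Not (All p))]).
      + intros q [<-|[<-|[]]]; auto. exists n. apply proves_imp.
        eapply proves_mono; [|exact C].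
        intros q [Hq|[<-|Hq]]; [left; left|right|left; right]; auto; reflexivity.
      + eapply prv_impE; apply prv_ax; simpl; [right; left; reflexivity|auto].
    - left; reflexivity. }
  destruct W as [k W]. apply (lim_prv [inst (Var k) p; Not (inst (Var k) p)]).
  - intros q [<-|[<-|[]]]; auto.
  - eapply prv_impE; apply prv_ax; simpl; [right; left; reflexivity|auto].
Qed.

End Lindenbaum.

(** The theory may have free variables below [N], interpreted by [r]. They act as constants, which
    later lets [Var 0] name a nonstandard element. *)
Lemma model_existence (Th : theory) (N : nat) :
  (forall p, Th p -> bound p <= N) -> ~ proves Th Fal ->
  exists (M : structure) (T : M -> Prop) (r : nat -> M),
    countable M /\ forall p, Th p -> sat T r p.
Proof.
  intros Hb Hc. destruct (countable_of_decoding _ _ decode_fm_surj) as [e He].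
  destruct (henkin_model _ (lim_prv Th N e) (lim_con Th N Hb Hc e)
    (lim_max Th N e He) (lim_henkin Th N Hb Hc e He)) as [M [T [r [H1 H2]]]].
  exists M, T, r. split; auto. intros p Hp. apply H2. exists 0.
  apply proves_ax. left; auto.
Qed.

(** For closed formulas satisfaction does not depend on the assignment, so the single assignment
    given by model existence stands for all of them. *)
Lemma completeness (Th : theory) (p : fm) :
  (forall q, Th q -> bound q = 0) -> bound p = 0 ->
  (forall (M : structure) (T : M -> Prop),
     (forall q r, Th q -> sat T r q) -> forall r, sat T r p) ->
  proves Th p.
Proof.
  intros Hb Hp H. apply proves_raa. apply NNPP. intros C.
  destruct (model_existence (union Th (axiom (Not p))) 0) as [M [T [r [_ K]]]]; auto.
  - intros q [Hq| ->]; simpl; [rewrite Hb; auto|]. rewrite Hp; auto.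
  - apply (K (Not p)); [right; reflexivity|]. apply H.
    intros q r' Hq. eapply sat_closed; [auto|]. apply K. left; exact Hq.
Qed.

(** * Arithmetic in models of PA *)

Section Relations.

Context {M : structure}.

Definition lt (x y : M) : Prop := exists z, add x (succ z) = y.

Definition pairs (x y z : M) : Prop :=
  add z z = add (mul (add x y) (succ (add x y))) (add y y).

Definition codes (s l c d : M) : Prop := exists p, pairs l p s /\ pairs c d p.

Definition beta (c d i y : M) : Prop :=
  lt y (succ (mul (succ i) d)) /\
  exists q, c = add (mul q (succ (mul (succ i) d))) y.

Definition length_of (s l : M) : Prop := exists c d, codes s l c d.

Definition entry (s i y : M) : Prop :=
  exists l c d, codes s l c d /\ beta c d i y.

Implicit Types (T : M -> Prop) (r : nat -> M).

Lemma eval_shift2 (x y : M) r (t : tm) :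
  eval (scons x (scons y r)) (shift 2 t) = eval r t.
Proof. unfold shift. rewrite eval_subst. reflexivity. Qed.

Lemma eval_shift3 (x y z : M) r (t : tm) :
  eval (scons x (scons y (scons z r))) (shift 3 t) = eval r t.
Proof. unfold shift. rewrite eval_subst. reflexivity. Qed.

Lemma sat_Lt T r (t u : tm) : sat T r (Lt t u) <-> lt (eval r t) (eval r u).
Proof.
  unfold Lt, lt. rewrite sat_ex. cbn [sat eval].
  setoid_rewrite eval_shift1. reflexivity.
Qed.

Lemma sat_AllLt T r (t : tm) (p : fm) :
  sat T r (AllLt t p) <-> forall x, lt x (eval r t) -> sat T (scons x r) p.
Proof.
  unfold AllLt. cbn [sat]. setoid_rewrite sat_Lt. setoid_rewrite eval_shift1.
  reflexivity.
Qed.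

Lemma sat_ExLt T r (t : tm) (p : fm) :
  sat T r (ExLt t p) <-> exists x, lt x (eval r t) /\ sat T (scons x r) p.
Proof.
  unfold ExLt. rewrite sat_ex. setoid_rewrite sat_and. setoid_rewrite sat_Lt.
  setoid_rewrite eval_shift1. reflexivity.
Qed.

Lemma sat_Code T r (s l c d : tm) :
  sat T r (Code s l c d) <-> codes (eval r s) (eval r l) (eval r c) (eval r d).
Proof.
  unfold Code, codes, pairs. rewrite sat_ex. setoid_rewrite sat_and.
  unfold Pair. cbn [sat eval]. setoid_rewrite eval_shift1. reflexivity.
Qed.

Lemma sat_Beta T r (c d i y : tm) :
  sat T r (Beta c d i y) <-> beta (eval r c) (eval r d) (eval r i) (eval r y).
Proof.
  unfold Beta, beta. rewrite sat_and, sat_Lt, sat_ex. cbn [sat eval].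
  setoid_rewrite eval_shift1. reflexivity.
Qed.

Lemma sat_Lh T r (s l : tm) : sat T r (Lh s l) <-> length_of (eval r s) (eval r l).
Proof.
  unfold Lh, length_of. rewrite sat_ex. setoid_rewrite sat_ex.
  setoid_rewrite sat_Code. setoid_rewrite eval_shift2. reflexivity.
Qed.

Lemma sat_Entry T r (s i y : tm) :
  sat T r (Entry s i y) <-> entry (eval r s) (eval r i) (eval r y).
Proof.
  unfold Entry, entry. rewrite sat_ex. setoid_rewrite sat_ex. setoid_rewrite sat_ex.
  setoid_rewrite sat_and. setoid_rewrite sat_Code. setoid_rewrite sat_Beta.
  setoid_rewrite eval_shift3. reflexivity.
Qed.

Definition T_at T (s i : M) : Prop := exists y, entry s i y /\ T y.

Lemma sat_T_entry T r (s i : tm) :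
  sat T r (T_entry s i) <-> T_at T (eval r s) (eval r i).
Proof.
  unfold T_entry, T_at. rewrite sat_ex. setoid_rewrite sat_and.
  setoid_rewrite sat_Entry. setoid_rewrite eval_shift1. reflexivity.
Qed.

Lemma sat_SeqInd T r :
  sat T r SeqInd <->
  forall s l, length_of s l -> T_at T s zero ->
    (forall i, lt (succ i) l -> T_at T s i -> T_at T s (succ i)) ->
    forall j, lt j l -> T_at T s j.
Proof.
  unfold SeqInd. cbn [sat]. setoid_rewrite sat_AllLt. setoid_rewrite sat_Lh.
  setoid_rewrite sat_Lt. setoid_rewrite sat_T_entry. reflexivity.
Qed.

Lemma sat_SeqOInd T r :
  sat T r SeqOInd <->
  forall s l, length_of s l ->
    (forall j, lt j l -> (forall i, lt i j -> T_at T s i) -> T_at T s j) ->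
    forall j, lt j l -> T_at T s j.
Proof.
  unfold SeqOInd. cbn [sat]. setoid_rewrite sat_AllLt. setoid_rewrite sat_Lh.
  cbn [sat]. setoid_rewrite sat_AllLt. setoid_rewrite sat_T_entry. reflexivity.
Qed.

(** Definability with parameters, held in [r], in the language without [T]: these are the sets to
    which the induction scheme of [PA] applies. *)
Definition definable (X : M -> Prop) : Prop :=
  exists p r, T_free p /\ forall x, X x <-> sat (fun _ => False) (scons x r) p.

End Relations.

(** This depends on the structure alone, so a model can be fixed first and [T] chosen afterwards.
    The next two lemmas translate to and from satisfaction of [PA]. *)
Record pa_model (M : structure) : Prop := {
  succ_neq_0 (x : M) : succ x <> zero;
  succ_inj (x y : M) : succ x = succ y -> x = y;
  add_0_r (x : M) : add x zero = x;
  add_succ_r (x y : M) : add x (succ y) = succ (add x y);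
  mul_0_r (x : M) : mul x zero = zero;
  mul_succ_r (x y : M) : mul x (succ y) = add (mul x y) x;
  definable_ind (X : M -> Prop) : definable X ->
    X zero -> (forall x, X x -> X (succ x)) -> forall x, X x
}.

Lemma pa_model_of_sat (M : structure) (T : M -> Prop) :
  (forall q r, PA q -> sat T r q) -> pa_model M.
Proof.
  intros H. set (r0 := fun _ : nat => @zero M). split.
  - intros x. apply (H _ r0 PA_succ_neq_0 x).
  - intros x y. apply (H _ r0 PA_succ_inj x y).
  - intros x. apply (H _ r0 PA_add_0 x).
  - intros x y. apply (H _ r0 PA_add_succ x y).
  - intros x. apply (H _ r0 PA_mul_0 x).
  - intros x y. apply (H _ r0 PA_mul_succ x y).
  - intros X [p [r [Tp HX]]] H0 HS.
    assert (E : forall x, X x <-> sat T (scons x r) p).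
    { intros x. rewrite HX. apply sat_T_free; auto. }
    intros x. apply E. revert x. refine (proj1 (sat_induction T r0 p) _ r _ _).
    + apply (H _ r0), PA_induction, Tp.
    + apply E, H0.
    + intros x Hx. apply E, HS, E, Hx.
Qed.

Lemma sat_of_pa_model (M : structure) (T : M -> Prop) :
  pa_model M -> forall q r, PA q -> sat T r q.
Proof.
  intros H q r [ | | | | | |p Tp]; cbn [sat Not eval scons].
  - apply succ_neq_0, H.
  - apply succ_inj, H.
  - apply add_0_r, H.
  - apply add_succ_r, H.
  - apply mul_0_r, H.
  - apply mul_succ_r, H.
  - apply sat_induction. intros r' H0 HS x.
    apply (definable_ind M H (fun x => sat T (scons x r') p)); auto.
    exists p, r'. split; auto. intros y. apply sat_T_free; auto.
Qed.

Declare Scope model_scope.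

Section Arithmetic.

Context {M : structure}.
Hypothesis HM : pa_model M.

Local Open Scope model_scope.
Local Notation "0" := (@zero M) : model_scope.
Local Notation "x + y" := (@add M x y) : model_scope.
Local Notation "x * y" := (@mul M x y) : model_scope.
Local Notation "x < y" := (@lt M x y) : model_scope.
Local Notation "'S' x" := (@succ M x) (at level 9, x at level 8) : model_scope.
Implicit Types (x y z a b c d i j k l q s : M) (X Y : M -> Prop).

Local Notation r0 := (fun _ : nat => @zero M).

(* Induction inside the model has to exhibit a [T]-free formula [p], with [Var 0] as induction
   variable, and an assignment [r] of its parameters. *)
Local Tactic Notation "pa_ind" constr(p) constr(r) constr(x) :=
  pattern x; apply (definable_ind M HM);
  [exists p, r; split; [simpl; tauto|]; intros; cbn [sat eval scons]; reflexivity | | ].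

(** * Semiring laws *)

Lemma add_0_l x : 0 + x = x.
Proof.
  pa_ind (Eq (Add Zero (Var 0)) (Var 0)) r0 x.
  - apply (add_0_r M HM).
  - intros y IH. rewrite (add_succ_r M HM). congruence.
Qed.

Lemma add_succ_l x y : S x + y = S (x + y).
Proof.
  pa_ind (Eq (Add (Succ (Var 1)) (Var 0)) (Succ (Add (Var 1) (Var 0)))) (scons x r0) y.
  - rewrite !(add_0_r M HM). auto.
  - intros z IH. rewrite !(add_succ_r M HM). congruence.
Qed.

Lemma add_comm x y : x + y = y + x.
Proof.
  pa_ind (Eq (Add (Var 1) (Var 0)) (Add (Var 0) (Var 1))) (scons x r0) y.
  - rewrite (add_0_r M HM), add_0_l. auto.
  - intros z IH. rewrite (add_succ_r M HM), add_succ_l. congruence.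
Qed.

Lemma add_assoc x y z : x + (y + z) = x + y + z.
Proof.
  pa_ind (Eq (Add (Var 1) (Add (Var 2) (Var 0))) (Add (Add (Var 1) (Var 2)) (Var 0)))
    (scons x (scons y r0)) z.
  - rewrite !(add_0_r M HM). auto.
  - intros u IH. rewrite !(add_succ_r M HM). congruence.
Qed.

Lemma mul_0_l x : 0 * x = 0.
Proof.
  pa_ind (Eq (Mul Zero (Var 0)) Zero) r0 x.
  - apply (mul_0_r M HM).
  - intros y IH. rewrite (mul_succ_r M HM), IH. apply (add_0_r M HM).
Qed.

Lemma mul_succ_l x y : S x * y = x * y + y.
Proof.
  pa_ind (Eq (Mul (Succ (Var 1)) (Var 0)) (Add (Mul (Var 1) (Var 0)) (Var 0)))
    (scons x r0) y.
  - rewrite !(mul_0_r M HM), (add_0_r M HM). auto.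
  - intros z IH. rewrite !(mul_succ_r M HM), !(add_succ_r M HM), IH.
    rewrite <- !add_assoc. rewrite (add_comm z x). auto.
Qed.

Lemma mul_comm x y : x * y = y * x.
Proof.
  pa_ind (Eq (Mul (Var 1) (Var 0)) (Mul (Var 0) (Var 1))) (scons x r0) y.
  - rewrite (mul_0_r M HM), mul_0_l. auto.
  - intros z IH. rewrite (mul_succ_r M HM), mul_succ_l. congruence.
Qed.

Lemma mul_add_distr_r x y z : (x + y) * z = x * z + y * z.
Proof.
  pa_ind (Eq (Mul (Add (Var 1) (Var 2)) (Var 0))
             (Add (Mul (Var 1) (Var 0)) (Mul (Var 2) (Var 0)))) (scons x (scons y r0)) z.
  - rewrite !(mul_0_r M HM), (add_0_r M HM). auto.
  - intros u IH. rewrite !(mul_succ_r M HM), IH, <- !add_assoc. f_equal.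
    rewrite !add_assoc. f_equal. apply add_comm.
Qed.

Lemma mul_assoc x y z : x * (y * z) = x * y * z.
Proof.
  pa_ind (Eq (Mul (Var 1) (Mul (Var 2) (Var 0))) (Mul (Mul (Var 1) (Var 2)) (Var 0)))
    (scons x (scons y r0)) z.
  - rewrite !(mul_0_r M HM). auto.
  - intros u IH. rewrite !(mul_succ_r M HM), <- IH.
    rewrite (mul_comm x (y * u + y)), mul_add_distr_r, !(mul_comm x). auto.
Qed.

Lemma mul_1_l x : S 0 * x = x.
Proof. rewrite mul_succ_l, mul_0_l. apply add_0_l. Qed.

Lemma M_semi_ring : semi_ring_theory 0 (S 0) (@add M) (@mul M) eq.
Proof.
  split; intros.
  - apply add_0_l.
  - apply add_comm.
  - apply add_assoc.
  - apply mul_1_l.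
  - apply mul_0_l.
  - apply mul_comm.
  - apply mul_assoc.
  - apply mul_add_distr_r.
Qed.

Add Ring M_ring : M_semi_ring.

Lemma succ_add x : S x = x + S 0.
Proof. rewrite (add_succ_r M HM), (add_0_r M HM). auto. Qed.

Local Ltac mring := repeat match goal with
  | |- context [@succ M ?x] => lazymatch x with 0 => fail | _ => rewrite (succ_add x) end
  end; ring.

Lemma add_cancel_r x y z : x + z = y + z -> x = y.
Proof.
  pa_ind (Imp (Eq (Add (Var 1) (Var 0)) (Add (Var 2) (Var 0))) (Eq (Var 1) (Var 2)))
    (scons x (scons y r0)) z.
  - rewrite !(add_0_r M HM). auto.
  - intros u IH. rewrite !(add_succ_r M HM). intros E. apply IH, (succ_inj M HM), E.
Qed.

Lemma add_cancel_l x y z : z + x = z + y -> x = y.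
Proof. rewrite !(add_comm z). apply add_cancel_r. Qed.

Lemma zero_or_succ x : x = 0 \/ exists y, x = S y.
Proof.
  assert (H : x <> 0 -> exists y, x = S y).
  { pattern x; apply (definable_ind M HM); [|tauto|eauto].
    exists (Imp (Not (Eq (Var 0) Zero)) (Ex (Eq (Var 1) (Succ (Var 0))))), r0.
    split; [simpl; tauto|]. intros y. cbn [sat Not eval scons].
    rewrite sat_ex. reflexivity. }
  destruct (classic (x = 0)); auto.
Qed.

(** * The order *)

Lemma lt_irrefl x : ~ x < x.
Proof.
  intros [z E]. rewrite <- (add_0_r M HM x) in E at 2. apply add_cancel_l in E.
  exact (succ_neq_0 M HM _ E).
Qed.

Lemma lt_trans x y z : x < y -> y < z -> x < z.
Proof. intros [a <-] [b <-]. exists (a + S b). mring. Qed.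

Lemma not_lt_0 x : ~ x < 0.
Proof. intros [z E]. rewrite (add_succ_r M HM) in E. exact (succ_neq_0 M HM _ E). Qed.

Lemma lt_succ_diag x : x < S x.
Proof. exists 0. mring. Qed.

Lemma lt_0_succ x : 0 < S x.
Proof. exists x. mring. Qed.

Lemma lt_succ_iff x y : x < S y <-> x < y \/ x = y.
Proof.
  split.
  - intros [z E]. rewrite (add_succ_r M HM) in E. apply (succ_inj M HM) in E.
    destruct (zero_or_succ z) as [->|[u ->]].
    + right. rewrite (add_0_r M HM) in E. auto.
    + left. exists u. auto.
  - intros [H| ->]; [|apply lt_succ_diag].
    eapply lt_trans; [exact H|apply lt_succ_diag].
Qed.

Lemma succ_lt_succ x y : x < y -> S x < S y.
Proof. intros [z <-]. exists z. mring. Qed.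

Lemma lt_total x y : x < y \/ x = y \/ y < x.
Proof.
  (* Written with implications and negations only, trichotomy is the direct meaning of a formula in
     the primitive connectives. *)
  assert (H : ~ x < y -> ~ y < x -> x = y).
  { pattern x; apply (definable_ind M HM).
    - exists (Imp (Not (Lt (Var 0) (Var 1))) (Imp (Not (Lt (Var 1) (Var 0)))
        (Eq (Var 0) (Var 1)))), (scons y r0).
      split; [simpl; tauto|]. intros z. cbn [sat Not eval scons].
      rewrite !sat_Lt. reflexivity.
    - intros H _. destruct (zero_or_succ y) as [->|[u ->]]; auto.
      destruct H. apply lt_0_succ.
    - intros z IH H1 H2. rewrite lt_succ_iff in H2.
      destruct (classic (z < y)) as [[u E]|K].
      + destruct (zero_or_succ u) as [->|[v ->]].
        * rewrite <- E. mring.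
        * destruct H1. exists v. rewrite <- E. mring.
      + exfalso. apply H2. right. symmetry. apply IH; tauto. }
  tauto.
Qed.

Lemma lt_le_trans x y z : x < y -> y < S z -> x < z.
Proof.
  rewrite lt_succ_iff. intros H [K| ->]; auto. exact (lt_trans _ _ _ H K).
Qed.

Lemma le_lt_trans x y z : x < S y -> y < z -> x < z.
Proof. rewrite lt_succ_iff. intros [H| ->]; auto. apply lt_trans; auto. Qed.

Lemma mul_lt_mono x y z : x < y -> x * S z < y * S z.
(* A witness for [lt] is the difference minus one; here $(u+1)(z+1)-1$. *)
Proof. intros [u <-]. exists (S u * z + u). mring. Qed.

Lemma mul_cancel_r x y z : z <> 0 -> x * z = y * z -> x = y.
Proof.
  intros Hz E. destruct (zero_or_succ z) as [->|[u ->]]; [tauto|].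
  destruct (lt_total x y) as [H|[H|H]]; auto; apply (mul_lt_mono _ _ u) in H;
    rewrite E in H; destruct (lt_irrefl _ H).
Qed.

Lemma square_lt x y : x < y -> x * x < y * y.
Proof.
  intros [u <-]. exists (S u * x + S u * x + S u * u + u). mring.
Qed.

Lemma square_inj x y : x * x = y * y -> x = y.
Proof.
  intros E. destruct (lt_total x y) as [H|[H|H]]; auto; apply square_lt in H;
    rewrite E in H; destruct (lt_irrefl _ H).
Qed.

(** * Definable sets and the least number principle *)

Lemma definable_not X : definable X -> definable (fun x => ~ X x).
Proof.
  intros [p [r [H K]]]. exists (Not p), r. split; [simpl; auto|].
  intros x. rewrite sat_not, K. reflexivity.
Qed.

Lemma definable_and X Y :
  definable X -> definable Y -> definable (fun x => X x /\ Y x).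
Proof.
  intros [p [r [Hp Kp]]] [q [u [Hq Kq]]].
  (* The two assignments are interleaved into one: its even positions carry the parameters of [p],
     its odd ones those of [q]. The shared [Var 0] in front shifts all indices by one. *)
  set (s1 := scons (Var 0) (fun n => Var (1 + 2 * n))%nat).
  set (s2 := scons (Var 0) (fun n => Var (2 + 2 * n))%nat).
  exists (And (subst s1 p) (subst s2 q)),
    (fun n => if Nat.even n then r (Nat.div2 n) else u (Nat.div2 n)).
  split; [simpl; auto 6 using T_free_subst|]. intros x. rewrite Kp, Kq, sat_and, !sat_subst.
  f_equiv; apply sat_ext; intros [|n] _; auto; cbn [eval s1 s2 scons Nat.add].
  - rewrite Nat.even_mul, Nat.div2_double. reflexivity.
  - rewrite Nat.even_succ, Nat.odd_mul, Nat.div2_succ_double. reflexivity.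
Qed.

Lemma definable_iff X Y : (forall x, X x <-> Y x) -> definable X -> definable Y.
Proof.
  intros H [p [r [H1 H2]]]. exists p, r. split; auto. intros x. rewrite <- H. auto.
Qed.

Lemma definable_or X Y :
  definable X -> definable Y -> definable (fun x => X x \/ Y x).
Proof.
  intros HX HY. apply definable_iff with (fun x => ~ (~ X x /\ ~ Y x)).
  - intros x. tauto.
  - apply definable_not, definable_and; apply definable_not; auto.
Qed.

Lemma definable_in (L : list M) : definable (fun x => In x L).
Proof.
  induction L as [|a L IH].
  - exists Fal, r0. split; simpl; tauto.
  - apply definable_or; auto. exists (Eq (Var 1) (Var 0)), (scons a r0).
    split; simpl; tauto.
Qed.

Lemma definable_lt b : definable (fun x => x < b).
Proof.
  exists (Lt (Var 0) (Var 1)), (scons b r0). split; [simpl; tauto|].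
  intros x. rewrite sat_Lt. reflexivity.
Qed.

Lemma definable_entry_below s k : definable (fun x => exists i, i < k /\ entry s i x).
Proof.
  exists (ExLt (Var 1) (Entry (Var 3) (Var 0) (Var 1))), (scons k (scons s r0)).
  split; [simpl; tauto|].
  intros x. rewrite sat_ExLt. setoid_rewrite sat_Entry. reflexivity.
Qed.

(** This allows the least number principle to select the first index of [s] whose entry lies in a
    definable set. *)
Lemma definable_index s X :
  definable X -> definable (fun i => exists y, entry s i y /\ X y).
Proof.
  intros [p [r [Hp Kp]]].
  set (u := scons (Var 0) (fun n => Var (3 + n))%nat).
  exists (Ex (And (Entry (Var 2) (Var 1) (Var 0)) (subst u p))), (scons s r).
  split.
  { pose proof (T_free_subst p u Hp). simpl; tauto. }
  intros i. rewrite sat_ex. setoid_rewrite sat_and. setoid_rewrite sat_Entry.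
  setoid_rewrite sat_subst. setoid_rewrite Kp. cbn [eval scons].
  f_equiv. intros y. f_equiv. apply sat_ext. intros [|n] _; reflexivity.
Qed.

(** If there were no least element, definable induction on the bound would show that [X] is empty
    below every bound. *)
Lemma least X : definable X -> forall x, X x ->
  exists y, X y /\ forall z, z < y -> ~ X z.
Proof.
  intros HX x Hx. apply NNPP. intros N.
  assert (K : forall z, z < S x -> ~ X z).
  { assert (D : definable (fun x => forall z, z < x -> ~ X z)).
    { destruct HX as [p [r [Hp Kp]]].
      set (u := scons (Var 0) (fun n => Var (2 + n))%nat).
      exists (AllLt (Var 0) (Not (subst u p))), r. split.
      { pose proof (T_free_subst p u Hp). simpl; tauto. }
      intros y. rewrite sat_AllLt. setoid_rewrite sat_not. setoid_rewrite sat_subst.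
      setoid_rewrite Kp. cbn [eval scons].
      split; intros H z Hz K; apply (H z Hz); revert K; apply sat_ext;
        intros [|n] _; reflexivity. }
    apply (definable_ind M HM _ D).
    - intros z H. destruct (not_lt_0 z H).
    - intros y IH z Hz. apply lt_succ_iff in Hz as [Hz| ->]; auto.
      intros Hy. apply N. eauto. }
  exact (K x (lt_succ_diag x) Hx).
Qed.

(** ** Coded sequences *)

Lemma division c m : exists q a, a < S m /\ c = q * S m + a.
Proof.
  pattern c; apply (definable_ind M HM).
  - exists (Ex (Ex (And (Lt (Var 0) (Succ (Var 3)))
      (Eq (Var 2) (Add (Mul (Var 1) (Succ (Var 3))) (Var 0)))))), (scons m r0).
    split; [simpl; tauto|]. intros x. rewrite sat_ex. setoid_rewrite sat_ex.
    setoid_rewrite sat_and. setoid_rewrite sat_Lt. reflexivity.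
  - exists 0, 0. split; [apply lt_0_succ|mring].
  - intros x [q [a [H ->]]]. apply lt_succ_iff in H as [H| ->].
    + exists q, (S a). split; [apply succ_lt_succ; auto|mring].
    + exists (S q), 0. split; [apply lt_0_succ|mring].
Qed.

Lemma remainder_unique q q' m a a' :
  q * m + a = q' * m + a' -> a < m -> a' < m -> a = a'.
Proof.
  assert (K : forall q q' a a', q * m + a = q' * m + a' -> a < m -> ~ q < q').
  { clear - HM. intros q q' a a' E H [z <-]. apply (lt_irrefl a).
    (* With [q' = q + z + 1], cancelling [q * m] leaves [a = (z + 1) * m + a'], which is at least
       [m] and so exceeds [a]; here [m] is written [a + w + 1]. *)
    destruct H as [w <-]. exists (w + z * (a + S w) + a').
    apply (add_cancel_l _ _ (q * (a + S w))). rewrite E. mring. }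
  intros E H H'. destruct (lt_total q q') as [Q|[<-|Q]].
  - destruct (K _ _ _ _ E H Q).
  - apply add_cancel_l in E. auto.
  - symmetry in E. destruct (K _ _ _ _ E H' Q).
Qed.

Lemma pairs_total x y : exists z, pairs x y z.
Proof.
  (* $w(w+1)$ is even; for [w = x + y] this provides the half needed in Cantor's formula. *)
  assert (H : forall w, exists z, z + z = w * S w).
  { intros w. pattern w; apply (definable_ind M HM).
    - exists (Ex (Eq (Add (Var 0) (Var 0)) (Mul (Var 1) (Succ (Var 1))))), r0.
      split; [simpl; tauto|]. intros v. rewrite sat_ex. reflexivity.
    - exists 0. mring.
    - intros v [z E]. exists (z + S v). transitivity (z + z + S v + S v); [mring|].
      rewrite E. mring. }
  destruct (H (x + y)) as [z E]. exists (z + y). unfold pairs. rewrite <- E. mring.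
Qed.

(** With $n=x+y$ the doubled code is $n(n+1)+2y$ where $y\le n$, which stays below $(n+1)(n+2)$.
    Equal codes thus have equal sums, and then [y] and [x] can be read off. *)
Lemma pairs_inj x y x' y' z : pairs x y z -> pairs x' y' z -> x = x' /\ y = y'.
Proof.
  unfold pairs. intros E E'. rewrite E in E'. clear E z.
  assert (K : forall x y x' y',
    (x + y) * S (x + y) + (y + y) = (x' + y') * S (x' + y') + (y' + y') ->
    ~ x + y < x' + y').
  { clear - HM. intros x y x' y' E [w H]. rewrite <- H in E.
    apply (lt_irrefl ((x + y) * S (x + y) + (y + y))). rewrite E at 2.
    exists (x + x + S 0 + w * (x + y + (x + y) + S S S 0) + w * w + y' + y'). mring. }
  destruct (lt_total (x + y) (x' + y')) as [H|[H|H]].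
  - destruct (K _ _ _ _ E' H).
  - rewrite H in E'. apply add_cancel_l in E'.
    assert (y = y').
    { destruct (lt_total y y') as [Y|[Y|Y]]; auto; destruct Y as [w <-]; exfalso;
      [apply (lt_irrefl (y + y)); rewrite E' at 2|apply (lt_irrefl (y' + y')); rewrite <- E' at 2];
      exists (S w + w); mring. }
    subst y'. apply add_cancel_r in H. auto.
  - symmetry in E'. destruct (K _ _ _ _ E' H).
Qed.

Lemma codes_inj s l c d l' c' d' :
  codes s l c d -> codes s l' c' d' -> l = l' /\ c = c' /\ d = d'.
Proof.
  intros [p [H K]] [p' [H' K']]. destruct (pairs_inj _ _ _ _ _ H H') as [-> ->].
  destruct (pairs_inj _ _ _ _ _ K K') as [-> ->]. auto.
Qed.

Lemma entry_fun s i y y' : entry s i y -> entry s i y' -> y = y'.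
Proof.
  intros [l [c [d [H [K [q E]]]]]] [l' [c' [d' [H' [K' [q' E']]]]]].
  destruct (codes_inj _ _ _ _ _ _ _ H H') as [_ [<- <-]].
  rewrite E in E'. eapply remainder_unique; eauto.
Qed.

Lemma entry_total s l i : length_of s l -> exists y, entry s i y.
Proof.
  intros [c [d H]]. destruct (division c (S i * d)) as [q [a [K E]]].
  exists a, l, c, d. split; auto. split; eauto.
Qed.

(** The multiple for [l + 1] is the one for [l] times [l + 1], so [K] is in effect a factorial; its
    existence is stated as a formula open to induction. *)
Lemma common_multiple l : exists K, K <> 0 /\ forall i, i < l -> exists q, q * S i = K.
Proof.
  pattern l; apply (definable_ind M HM).
  - exists (Ex (And (Not (Eq (Var 0) Zero))
      (AllLt (Var 1) (Ex (Eq (Mul (Var 0) (Succ (Var 1))) (Var 2)))))), r0.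
    split; [simpl; tauto|]. intros x. rewrite sat_ex. setoid_rewrite sat_and.
    setoid_rewrite sat_AllLt. setoid_rewrite sat_ex. reflexivity.
  - exists (S 0). split; [apply (succ_neq_0 M HM)|].
    intros i H. destruct (not_lt_0 _ H).
  - intros x [K [K0 H]]. exists (K * S x). split.
    + intros E. apply K0. apply (mul_cancel_r _ _ (S x)); [apply (succ_neq_0 M HM)|].
      rewrite E. mring.
    + intros i Hi. apply lt_succ_iff in Hi as [Hi| ->]; eauto.
      destruct (H i Hi) as [q <-]. exists (q * S x). mring.
Qed.

(* If [K] is divisible by [i + 1] for all [i < l], then modulo [m = 1 + (i + 1) d]
   we have [(i + 1) d = -1], so [K^2 d^2 = (K / (i + 1))^2], and for [d = K^2] the
   right-hand side is below [m]. This gives an injective sequence without the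
   Chinese remainder theorem. *)
Lemma injective_sequence l : exists s, length_of s l /\
  forall i j y, i < l -> j < l -> entry s i y -> entry s j y -> i = j.
Proof.
  destruct (common_multiple l) as [K [K0 HK]].
  destruct (zero_or_succ K) as [|[k Ek]]; [tauto|].
  set (d := K * K). set (c := K * K * (d * d)).
  destruct (pairs_total c d) as [p Hp], (pairs_total l p) as [s Hs].
  assert (Hc : codes s l c d) by (exists p; auto).
  exists s. split; [exists c, d; auto|].
  assert (He : forall i, i < l -> exists q, q * S i = K /\ entry s i (q * q)).
  { intros i Hi. destruct (HK i Hi) as [q Hq]. exists q. split; auto.
    exists l, c, d. split; auto. split.
    (* Since $d=q^2(i+1)^2$, the modulus is $1+q^2(i+1)^3$, and the witness is $q^2((i+1)^3-1)$. *)
    - exists (q * q * (i * i * i + i * i + i * i + i * i + i + i + i)).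
      unfold d. rewrite <- Hq. mring.
    (* With $(i+1)d=e+1$ the modulus is $e+2$, and $c=q^2(e+1)^2=q^2e(e+2)+q^2$; so the quotient is
       $q^2e$ and the entry $q^2$. *)
    - assert (Hd : exists e, S i * d = S e).
      { unfold d. rewrite Ek. exists (S i * k * S k + S i * k + i). mring. }
      destruct Hd as [e He]. exists (q * q * e). rewrite He.
      unfold c. transitivity (q * q * (S i * d * (S i * d))).
      + rewrite <- Hq at 1 2. mring.
      + rewrite He. mring. }
  intros i j y Hi Hj Ei Ej.
  destruct (He i Hi) as [q [Hq Eq]], (He j Hj) as [q' [Hq' Eq']].
  assert (E : q * q = q' * q').
  { rewrite (entry_fun _ _ _ _ Eq Ei). symmetry. exact (entry_fun _ _ _ _ Eq' Ej). }
  apply square_inj in E. subst q'.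
  apply (succ_inj M HM), (mul_cancel_r _ _ q).
  - intros ->. apply K0. rewrite <- Hq. mring.
  - rewrite !(mul_comm _ q). congruence.
Qed.

(** * The two implications *)

Lemma IDelta0T_SeqOInd (T : M -> Prop) :
  (forall (q : fm) r, IDelta0T q -> sat T r q) -> forall r, sat T r SeqOInd.
Proof.
  intros HT r. apply sat_SeqOInd. intros s l [c [d Hc]] Hprog.
  assert (He : forall i y, entry s i y <-> beta c d i y).
  { intros i y. split.
    - intros [l' [c' [d' [H K]]]].
      destruct (codes_inj _ _ _ _ _ _ _ Hc H) as [_ [<- <-]]. auto.
    - intros H. exists l, c, d. auto. }
  (* [forall i < l, i < x -> T (s_i)], the unbounded quantifiers of [T_entry]
     being bounded by [c + 1]; [i < x] is written [exists z < x, z = i]. *)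
  set (m := Succ (Mul (Succ (Var 2)) (Var 6))).
  set (p := AllLt (Var 1) (Imp (ExLt (Var 1) (Eq (Var 0) (Var 1)))
    (ExLt (Succ (Var 3)) (ExLt (Succ (Var 4))
      (And (ExLt m (Eq (Var 0) (Var 2)))
        (And (Eq (Var 5) (Add (Mul (Var 0) m) (Var 1))) (Tr (Var 1)))))))).
  assert (Dp : Delta0 p).
  { unfold p. repeat first [apply Delta0_ex | apply Delta0_all | apply Delta0_T
      | apply Delta0_eq | apply Delta0_fal | apply Delta0_imp]. }
  set (u := scons l (scons c (scons d r0))).
  assert (Hp : forall x, sat T (scons x u) p <->
                 forall i, i < l -> i < x -> T_at T s i).
  { intros x. unfold p. rewrite sat_AllLt. cbn [sat].
    setoid_rewrite sat_ExLt. setoid_rewrite sat_ExLt. setoid_rewrite sat_and.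
    setoid_rewrite sat_and. setoid_rewrite sat_ExLt.
    cbn [sat eval scons u m]. split.
    - intros H i Hi Hx. destruct (H i Hi) as [y [_ [q [_ [[z [Hz ->]] [E Ty]]]]]].
      { eauto. }
      exists y. split; auto. apply He. split; eauto.
    - intros H i Hi [z [Hz ->]]. destruct (H i Hi Hz) as [y [Hy Ty]].
      (* The equation gives [c] as a multiple of a positive modulus by [q], plus [y], so [y] and [q]
         are at most [c]; the witnesses below are [c - y] and [c - q]. *)
      apply He in Hy as [Hy [q E]]. exists y. split.
      { exists (q * S (S i * d)). rewrite E. mring. }
      exists q. split.
      { exists (q * (S i * d) + y). rewrite E. mring. }
      repeat split; eauto. }
  assert (HI : forall x, sat T (scons x u) p).
  { refine (proj1 (sat_induction T r0 p) _ u _ _).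
    - apply HT. exists p. auto.
    - apply Hp. intros i _ H. destruct (not_lt_0 _ H).
    - intros x. rewrite !Hp. intros H i Hi Hx.
      apply lt_succ_iff in Hx as [Hx| ->]; auto. apply Hprog; auto.
      intros j Hj. apply H; auto. eapply lt_trans; eauto. }
  intros j Hj. apply (proj1 (Hp (S j)) (HI (S j)) j Hj), lt_succ_diag.
Qed.

(** The hypotheses of [SeqInd] make [T] progressive along [s]: index zero is given, and a successor
    index follows from its predecessor. *)
Lemma SeqOInd_SeqInd (T : M -> Prop) (r : nat -> M) :
  sat T r SeqOInd -> sat T r SeqInd.
Proof.
  rewrite sat_SeqOInd, sat_SeqInd. intros H s l Hl H0 HS. apply (H s l Hl).
  intros j Hj IH. destruct (zero_or_succ j) as [->|[i ->]]; auto.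
  apply HS; auto. apply IH, lt_succ_diag.
Qed.

(** * Nonstandard elements *)

Definition std x : Prop := exists n, x = Nat.iter n (@succ M) 0.

Lemma std_succ x : std (S x) <-> std x.
Proof.
  split; intros [n H].
  - destruct n; simpl in H; [destruct (succ_neq_0 M HM _ H)|].
    apply (succ_inj M HM) in H. exists n; auto.
  - exists (Datatypes.S n). simpl. congruence.
Qed.

Lemma std_0 : std 0.
Proof. exists 0%nat. reflexivity. Qed.

Lemma std_lt x y : std y -> x < y -> std x.
Proof.
  intros [n ->]. revert x. induction n; simpl; intros x H.
  - destruct (not_lt_0 _ H).
  - apply lt_succ_iff in H as [H| ->]; auto. exists n; auto.
Qed.

Lemma std_lt_nonstd x y : std x -> ~ std y -> x < y.
Proof.
  intros H K. destruct (lt_total x y) as [|[->|Y]]; auto; [tauto|].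
  destruct K. eapply std_lt; eauto.
Qed.

Lemma nonstd_pred x : ~ std x -> exists y, ~ std y /\ y < x.
Proof.
  intros H. destruct (zero_or_succ x) as [->|[y ->]]; [destruct H; apply std_0|].
  rewrite std_succ in H. exists y. split; auto. apply lt_succ_diag.
Qed.

Lemma nonstd_min x y : ~ std x -> ~ std y ->
  exists z, ~ std z /\ z < S x /\ z < S y.
Proof.
  intros H K. destruct (lt_total x y) as [L|[->|L]].
  - exists x. split; auto. split; [apply lt_succ_diag|]. apply lt_succ_iff; auto.
  - exists y. split; auto. split; apply lt_succ_diag.
  - exists y. split; auto. split; [apply lt_succ_iff; auto|apply lt_succ_diag].
Qed.

End Arithmetic.

(** * Generic predicates *)

(** A Rasiowa-Sikorski construction: [inv] singles out the legitimate conditions, [ext] is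
    extension, and the requirements [R i] are enumerated and met one at a time. *)
Lemma generic_sequence (C I : Type) (inv : C -> Prop) (ext : C -> C -> Prop)
    (R : I -> C -> Prop) (c0 : C) :
  countable I -> inv c0 ->
  (forall c, ext c c) -> (forall a b c, ext a b -> ext b c -> ext a c) ->
  (forall i c, inv c -> exists c', inv c' /\ ext c c' /\ R i c') ->
  exists g : nat -> C,
    (forall n, inv (g n)) /\ (forall n m, n <= m -> ext (g n) (g m)) /\
    (forall i, exists n, R i (g n)).
Proof.
  intros [e He] H0 Hrefl Htrans Hstep.
  assert (St : forall i c, {c' | inv c -> inv c' /\ ext c c' /\ R i c'}).
  { intros i c. apply constructive_indefinite_description.
    destruct (classic (inv c)) as [H|H].
    - destruct (Hstep i c H) as [c' K]. eauto.
    - exists c. tauto. }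
  set (g := fix g n := match n with 0 => c0 | S n => proj1_sig (St (e n) (g n)) end).
  assert (Hg : forall n, inv (g n)).
  { induction n; simpl; auto. destruct (St (e n) (g n)) as [c' K]; simpl. apply K, IHn. }
  exists g. split; auto. split.
  - induction 1; auto. eapply Htrans; [exact IHle|]. simpl.
    destruct (St (e m) (g m)) as [c' K]; simpl. apply K, Hg.
  - intros i. destruct (He i) as [n <-]. exists (S n). simpl.
    destruct (St (e n) (g n)) as [c' K]; simpl. apply K, Hg.
Qed.

(** Requirements are indexed in this way: the boolean selects one of two kinds, the pair holds the
    parameters. *)
Lemma countable_bool_prod (A : Type) : countable A -> countable (bool * (A * A)).
Proof.
  intros [e He].
  exists (fun n => let (t, m) := of_nat n in let (a, b) := of_nat m in
                   (Nat.eqb t 0, (e a, e b))).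
  intros [t [x y]]. destruct (He x) as [a <-], (He y) as [b <-].
  exists (to_nat ((if t then 0 else 1), to_nat (a, b))).
  rewrite !cancel_of_to. destruct t; reflexivity.
Qed.

Section Generic.

Context {M : structure}.
Hypothesis HM : pa_model M.
Hypothesis M_countable : countable M.
Variable w : M.
Hypothesis w_nonstd : ~ std w.

Local Open Scope model_scope.
Local Notation "0" := (@zero M) : model_scope.
Local Notation "x < y" := (@lt M x y) : model_scope.
Local Notation "'S' x" := (@succ M x) (at level 9, x at level 8) : model_scope.
Implicit Types (x y z a b c d i j k l q s : M).

(* A condition [(A, L)] puts the set [A] into [T] and the list [L] out of it; both
   lie above some nonstandard [c], so no standard number ever enters [T]. Given a
   sequence [s], look for the first [i] with [s_i < c] or [s_i] in [L]: everything
   before it can be put into [T], and [s_i] left out. *)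
Lemma SeqOInd_without_IDelta0T : exists T : M -> Prop,
  (forall r, sat T r SeqOInd) /\
  (exists x, T x) /\ (forall x, T x -> exists y, y < x /\ T y).
Proof.
  set (C := ((M -> Prop) * list M)%type).
  set (inv := fun p : C => exists c, ~ std c /\ (forall x, fst p x -> ~ x < c) /\
    (forall x, In x (snd p) -> ~ x < c) /\ (forall x, In x (snd p) -> ~ fst p x)).
  set (ext := fun p p' : C =>
    (forall x, fst p x -> fst p' x) /\ (forall x, In x (snd p) -> In x (snd p'))).
  (* Kind [true]: the entries of [s] up to index [j] are all put into [T], or some entry among them
     stays out while all earlier ones are put in. Kind [false]: an element below each nonstandard
     [s] is put into [T], so that [T] has no least element. *)
  set (R := fun (t : bool * (M * M)) (p : C) =>
    let (s, j) := snd t in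
    if fst t then
      (forall k y, k < S j -> entry s k y -> fst p y) \/
      exists i y, i < S j /\ entry s i y /\ (std y \/ In y (snd p)) /\
        forall k z, k < i -> entry s k z -> fst p z
    else ~ std s -> exists y, y < s /\ fst p y).
  destruct (generic_sequence C (bool * (M * M)) inv ext R (fun _ => False, []))
    as [g [Hinv [Hext HR]]].
  - apply countable_bool_prod, M_countable.
  - exists w. simpl. tauto.
  - split; auto.
  - intros p1 p2 p3 [H1 H2] [K1 K2]. split; auto.
  - intros [t [s j]] [A L] [c [Hc [HA [HL HAL]]]]; cbn [fst snd] in *. destruct t.
    + set (X := fun y => y < c \/ In y L).
      assert (DX : definable (fun k => exists y, entry s k y /\ X y)).
      { apply definable_index, definable_or;
          [apply definable_lt|apply definable_in]. }
      destruct (classic (exists k, k < S j /\ exists y, entry s k y /\ X y))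
        as [[k [Hk Hy]]|N].
      * destruct (least HM _ DX k Hy) as [i [[y [Ey Xy]] Hmin]].
        assert (Hij : i < S j).
        { destruct (lt_total HM i k) as [L1|[->|L1]]; auto.
          - eapply lt_trans; eauto.
          - destruct (Hmin k L1 Hy). }
        set (A' := fun z => A z \/ exists k, k < i /\ entry s k z).
        assert (HA' : forall z, A' z -> ~ X z).
        { intros z [Az|[k' [Hk' Ez]]] [Xz|Xz]; [exact (HA z Az Xz)|exact (HAL z Xz Az)| |];
            apply (Hmin k' Hk'); exists z; split; auto; [left|right]; auto. }
        assert (HRA : forall k z, k < i -> entry s k z -> A' z).
        { intros k' z H1 H2. right. eauto. }
        (* A standard [y] is kept out by [inv] already. A nonstandard one joins the list, and the
           threshold [c] is lowered so as not to exceed it. *)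
        destruct (classic (std y)) as [Sy|Sy].
        -- exists (A', L). split; [|split].
           ++ exists c. cbn [fst snd]. repeat split; auto.
              ** intros z Az Hz. apply (HA' z Az). left; auto.
              ** intros z Lz Az. apply (HA' z Az). right; auto.
           ++ split; cbn [fst snd]; auto. left; auto.
           ++ right. exists i, y. cbn [fst snd]. auto.
        -- exists (A', y :: L). split; [|split].
           ++ destruct (nonstd_min HM c y Hc Sy) as [c' [Hc' [H1 H2]]].
              assert (HX : forall z, ~ z < c -> ~ z < c').
              { intros z Hz Hz'. apply Hz. eapply lt_le_trans; eauto. }
              exists c'. cbn [fst snd]. repeat split; auto.
              ** intros z Az. apply HX. intros Hz. apply (HA' z Az). left; auto.
              ** intros z [<-|Lz]; auto. intros Hz.
                 apply (lt_irrefl HM y). eapply lt_le_trans; eauto.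
              ** intros z Lz Az. apply (HA' z Az). destruct Lz as [<-|Lz]; auto.
                 right; auto.
           ++ split; cbn [fst snd]; [left; auto|right; auto].
           ++ right. exists i, y. cbn [fst snd]. repeat split; auto. right; left; auto.
      * set (A' := fun z => A z \/ exists k, k < S j /\ entry s k z).
        assert (HA' : forall z, A' z -> ~ X z).
        { intros z [Az|[k' [Hk' Ez]]] [Xz|Xz]; [exact (HA z Az Xz)|exact (HAL z Xz Az)| |];
            apply N; exists k'; split; auto; exists z; split; auto; [left|right]; auto. }
        exists (A', L). split; [|split].
        -- exists c. cbn [fst snd]. repeat split; auto.
           ++ intros z Az Hz. apply (HA' z Az). left; auto.
           ++ intros z Lz Az. apply (HA' z Az). right; auto.
        -- split; cbn [fst snd]; auto. left; auto.
        -- left. cbn [fst snd]. intros k z H1 H2. right. eauto.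
    + destruct (classic (std s)) as [Ss|Ss].
      { exists (A, L). split; [exists c; auto|]. split; [split; auto|].
        unfold R. cbn [fst snd]. tauto. }
      (* A nonstandard [b] below both [s] and [c] is put into [T]. Being below [c] it is not in [L],
         and it becomes the new threshold. *)
      destruct (nonstd_min HM c s Hc Ss) as [c' [Hc' [H1 H2]]].
      destruct (nonstd_pred HM c' Hc') as [b [Hb Hbc]].
      assert (Bc : b < c) by (eapply lt_le_trans; eauto).
      exists ((fun x => A x \/ x = b), L). split; [|split].
      * exists b. cbn [fst snd]. repeat split; auto.
        -- intros x [Ax| ->]; [|apply lt_irrefl; auto]. intros Hx. apply (HA x Ax).
           eapply lt_trans; eauto.
        -- intros x Lx Hx. apply (HL x Lx). eapply lt_trans; eauto.
        -- intros x Lx [Ax| ->]; [exact (HAL x Lx Ax)|exact (HL b Lx Bc)].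
      * split; cbn [fst snd]; auto.
      * intros _. exists b. cbn [fst snd]. split; auto. apply (lt_le_trans HM _ c'); auto.
  - exists (fun x => exists n, fst (g n) x).
    assert (HT : forall x n, fst (g n) x -> ~ std x).
    { intros x n Hx Sx. destruct (Hinv n) as [c [Hc [HA _]]]. apply (HA x Hx).
      apply std_lt_nonstd; auto. }
    assert (Hdense : forall x, ~ std x -> exists y, y < x /\ exists n, fst (g n) y).
    { intros x Hx. destruct (HR (false, (x, x))) as [n Hn]. cbn in Hn.
      destruct (Hn Hx) as [y [Hy Ay]]. eauto. }
    split; [|split].
    + intros r. apply sat_SeqOInd. intros s l Hl Hprog j Hj.
      assert (HA : forall n k, (forall y, entry s k y -> fst (g n) y) ->
                     T_at (fun x => exists n, fst (g n) x) s k).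
      { intros n k H. destruct (entry_total HM s l k Hl) as [y Ey]. exists y. eauto. }
      destruct (HR (true, (s, j))) as [n [Hn|Hn]]; cbn [fst snd] in Hn.
      { apply (HA n). intros y. apply Hn, lt_succ_diag; auto. }
      (* The entries before [i] are in [T], so progressiveness puts the entry [y] at [i] into [T];
         yet [y] is standard or excluded at some stage. *)
      destruct Hn as [i [y [Hi [Ey [Hy Hbelow]]]]]. exfalso.
      destruct (Hprog i) as [y' [Ey' [m Hm]]].
      * eapply le_lt_trans; eauto.
      * intros k Hk. apply (HA n). intros z. apply Hbelow; auto.
      * rewrite (entry_fun HM s i y' y Ey' Ey) in Hm.
        destruct Hy as [Hy|Hy]; [exact (HT y m Hm Hy)|].
        destruct (Hinv (Nat.max n m)) as [c [_ [_ [_ H]]]]. apply (H y).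
        -- apply (Hext n); [lia|auto].
        -- apply (Hext m); [lia|auto].
    + destruct (Hdense w w_nonstd) as [y [_ Hy]]. eauto.
    + intros x [n Hx]. apply Hdense. eauto.
Qed.

(* Conditions are finite: [P] goes into [T] and [N] out of it, while [T] contains
   all standard-index entries of a fixed injective sequence [s0] of nonstandard
   length, and [SeqOInd] is made to fail along [s0]. *)
Lemma SeqInd_without_SeqOInd : exists T : M -> Prop,
  (forall r, sat T r SeqInd) /\ forall r, ~ sat T r SeqOInd.
Proof.
  destruct (injective_sequence HM w) as [s0 [Hl0 Hinj]].
  set (J := fun x => exists k, std k /\ entry s0 k x).
  set (C := (list M * list M)%type).
  set (inv := fun p : C => forall x, In x (snd p) -> ~ J x /\ ~ In x (fst p)).
  set (ext := fun p p' : C =>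
    (forall x, In x (fst p) -> In x (fst p')) /\ (forall x, In x (snd p) -> In x (snd p'))).
  (* Kind [true]: the first entry of [s] stays out, or the [j]-th is put in, or two consecutive
     entries up to [j] lead from inside to outside; each case yields [SeqInd] for [s] at [j]. Kind
     [false]: below each nonstandard index [s] of [s0], with [s] at most [w], some entry stays
     out. *)
  set (R := fun (t : bool * (M * M)) (p : C) =>
    let (s, j) := snd t in
    if fst t then
      forall y0 yj, entry s 0 y0 -> entry s j yj ->
      In y0 (snd p) \/ (J yj \/ In yj (fst p)) \/
      exists i a b, i < j /\ entry s i a /\ entry s (S i) b /\
        (J a \/ In a (fst p)) /\ In b (snd p)
    else ~ std s -> s < S w -> exists k y, k < s /\ entry s0 k y /\ In y (snd p)).
  (* By injectivity each member of the finite list occurs at no more than one nonstandard index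
     below [w], so a nonstandard [v] can be chosen that exceeds none of these indices. *)
  assert (Hsep : forall (L : list M) m, ~ std m -> m < S w ->
    exists v, ~ std v /\ v < S m /\
      forall x k, In x L -> k < v -> ~ std k -> ~ entry s0 k x).
  { intros L m Hm Hw. induction L as [|a L [v [Hv [Hvm IH]]]].
    - exists m. split; auto. split; [apply lt_succ_diag; auto|]. intros x k [].
    - destruct (classic (exists k, ~ std k /\ k < w /\ entry s0 k a))
        as [[k [Hk [Hkw Ek]]]|N].
      + destruct (nonstd_min HM v k Hv Hk) as [v' [Hv' [H1 H2]]].
        exists v'. split; auto. split.
        { apply (le_lt_trans HM _ v); auto. }
        intros x i [<-|Hx] Hi Hsi Ei.
        * assert (Hik : i < k) by (eapply lt_le_trans; eauto).
          apply (lt_irrefl HM i). rewrite (Hinj i k a) at 2; auto.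
          eapply lt_trans; eauto.
        * apply (IH x i Hx); auto. eapply lt_le_trans; eauto.
      + exists v. split; auto. split; auto. intros x i [<-|Hx] Hi Hsi Ei; [|eapply IH; eauto].
        apply N. exists i. repeat split; auto.
        eapply lt_le_trans; eauto. apply (le_lt_trans HM _ m); auto. }
  destruct (generic_sequence C (bool * (M * M)) inv ext R ([], []))
    as [g [Hinv [Hext HR]]].
  - apply countable_bool_prod, M_countable.
  - intros x [].
  - split; auto.
  - intros p1 p2 p3 [H1 H2] [K1 K2]. split; auto.
  - intros [t [s j]] [P N] HN; unfold inv, ext, R; cbn [fst snd] in *. destruct t.
    + destruct (classic (exists y0 yj, entry s 0 y0 /\ entry s j yj))
        as [[y0 [yj [E0 Ej]]]|Nex].
      2: { exists (P, N). repeat split; auto; try (apply HN; auto).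
           intros y0 yj H1 H2. destruct Nex; eauto. }
      assert (Hfun : forall (p : C), (In y0 (snd p) \/ (J yj \/ In yj (fst p)) \/
        exists i a b, i < j /\ entry s i a /\ entry s (S i) b /\
          (J a \/ In a (fst p)) /\ In b (snd p)) -> R (true, (s, j)) p).
      { intros p H z0 zj F0 Fj. rewrite (entry_fun HM _ _ _ _ F0 E0).
        rewrite (entry_fun HM _ _ _ _ Fj Ej). exact H. }
      destruct (classic (J y0 \/ In y0 P)) as [Hy0|Hy0].
      2: { exists (P, y0 :: N). split; [|split; [|apply Hfun; left; left; auto]].
           - intros x [<-|Hx]; [tauto|apply HN; auto].
           - split; auto. right; auto. }
      destruct (classic (J yj \/ In yj P)) as [Hyj|Hyj].
      { exists (P, N). split; [exact HN|]. split; [split; auto|]. apply Hfun. auto. }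
      assert (HN1 : forall x, In x (yj :: N) -> ~ J x /\ ~ In x P).
      { intros x [<-|Hx]; [tauto|apply HN; auto]. }
      destruct (Hsep (yj :: N) w w_nonstd (lt_succ_diag HM w)) as [v [Hv [_ Hvx]]].
      (* The standard indices form an undefinable cut; replacing it by [k < v] makes [X] definable.
         It still contains [J] and [P], and the choice of [v] keeps [yj] and [N] outside. *)
      set (X := fun y => (exists k, k < v /\ entry s0 k y) \/ In y P).
      assert (DX : definable (fun k => exists y, entry s k y /\ ~ X y)).
      { apply definable_index, definable_not, definable_or;
          [apply definable_entry_below|apply definable_in]. }
      assert (HX : forall x, J x \/ In x P -> X x).
      { intros x [[k [Sk Ek]]|Hx]; [left|right; auto]. exists k. split; auto.
        apply std_lt_nonstd; auto. }
      assert (HNX : forall x, In x (yj :: N) -> ~ X x).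
      { intros x Hx [[k [Hk Ek]]|Px]; [|exact (proj2 (HN1 x Hx) Px)].
        destruct (classic (std k)) as [Sk|Sk]; [|exact (Hvx x k Hx Hk Sk Ek)].
        apply (proj1 (HN1 x Hx)). exists k; auto. }
      destruct (least HM _ DX j) as [i [[b [Eb Xb]] Hmin]].
      { exists yj. split; auto. apply HNX. left; auto. }
      (* The first entry lies in [X], so the least index leaving [X] is a successor and the entry
         just before it is in [X]. *)
      destruct (zero_or_succ HM i) as [->|[i' ->]].
      { exfalso. apply Xb. rewrite (entry_fun HM _ _ _ _ Eb E0). auto. }
      assert (exists l, length_of s l) as [l Hl].
      { destruct E0 as [l [c [d [Hc _]]]]. exists l, c, d. auto. }
      destruct (entry_total HM s l i' Hl) as [a Ea].
      assert (Xa : X a).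
      { apply NNPP. intros Na. apply (Hmin i' (lt_succ_diag HM i')). eauto. }
      assert (Hij : i' < j).
      { destruct (lt_total HM i' j) as [|[->|H]]; auto; exfalso.
        - apply (Hmin j (lt_succ_diag HM j)). exists yj. split; auto. apply HNX. left; auto.
        - apply (Hmin j).
          + apply (lt_trans HM _ i'); [auto|apply lt_succ_diag; auto].
          + exists yj. split; auto. apply HNX. left; auto. }
      exists (a :: P, b :: yj :: N). split; [|split].
      (* Everything put in lies in [X] and everything kept out lies outside it, so the new condition
         is consistent. *)
      * assert (HN2 : forall x, In x (b :: yj :: N) -> ~ X x).
        { intros x [<-|Hx]; auto. }
        intros x Hx. apply HN2 in Hx. split; [intros Jx; apply Hx; auto|].
        intros [<-|Px]; [auto|]. apply Hx. right; auto.
      * split; intros x Hx; [right|right; right]; auto.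
      * apply Hfun. right; right. exists i', a, b. cbn [fst snd].
        repeat split; auto; [right|]; left; auto.
    + destruct (classic (std s \/ ~ s < S w)) as [Ss|Ss].
      { exists (P, N). repeat split; auto; try (apply HN; auto). tauto. }
      (* At a nonstandard index [k < v] the entry of [s0] is not in [P], and injectivity keeps it
         out of [J]; so it may be excluded. *)
      destruct (Hsep P s) as [v [Hv [Hvs H]]]; [tauto..|].
      destruct (nonstd_pred HM v Hv) as [k [Hk Hkv]].
      destruct (entry_total HM s0 w k Hl0) as [y Ey].
      assert (Hks : k < s) by (eapply lt_le_trans; eauto).
      exists (P, y :: N). split; [|split].
      * intros x [<-|Hx]; [|apply HN; auto]. split.
        -- intros [i [Si Ei]]. apply Hk.
           rewrite (Hinj k i y); auto.
           ++ eapply lt_le_trans; eauto. tauto.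
           ++ apply std_lt_nonstd; auto.
        -- intros Py. exact (H y k Py Hkv Hk Ey).
      * split; auto. right; auto.
      * intros _ _. exists k, y. cbn [fst snd]. repeat split; auto. left; auto.
  - exists (fun x => J x \/ exists n, In x (fst (g n))).
    assert (HT : forall x n, In x (snd (g n)) -> ~ (J x \/ exists n, In x (fst (g n)))).
    { intros x n Hx [K|[m K]]; [exact (proj1 (Hinv n x Hx) K)|].
      refine (proj2 (Hinv (Nat.max n m) x _) _).
      - apply (Hext n); [lia|auto].
      - apply (Hext m); [lia|auto]. }
    split.
    + intros r. apply sat_SeqInd. intros s l Hl [y0 [E0 T0]] HS j Hj.
      destruct (entry_total HM s l j Hl) as [yj Ej].
      destruct (HR (true, (s, j))) as [n Hn].
      destruct (Hn y0 yj E0 Ej) as [H|[H|H]].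
      * destruct (HT _ _ H T0).
      * exists yj. split; auto. destruct H; eauto.
      * destruct H as [i [a [b [Hi [Ea [Eb [Ha Hb]]]]]]].
        destruct (HS i) as [b' [Eb' Tb]].
        -- apply (lt_le_trans HM _ (S j)); [apply succ_lt_succ; auto|].
           apply succ_lt_succ; auto.
        -- exists a. split; auto. destruct Ha; eauto.
        -- rewrite (entry_fun HM _ _ _ _ Eb' Eb) in Tb. destruct (HT _ _ Hb Tb).
    + assert (Hfail : forall m, ~ std m -> m < S w -> exists k, k < m /\
        ~ T_at (fun x => J x \/ exists n, In x (fst (g n))) s0 k).
      { intros m Hm Hmw. destruct (HR (false, (m, m))) as [n Hn].
        destruct (Hn Hm Hmw) as [k [y [Hk [Ey Ny]]]]. exists k. split; auto.
        intros [y' [Ey' Ty]]. rewrite (entry_fun HM _ _ _ _ Ey' Ey) in Ty.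
        exact (HT y n Ny Ty). }
      intros r HO. rewrite sat_SeqOInd in HO. specialize (HO s0 w Hl0).
      destruct (Hfail w w_nonstd (lt_succ_diag HM w)) as [k [Hk Nk]].
      apply Nk, HO; auto. clear k Hk Nk. intros j Hj IH.
      (* [T] is progressive along [s0]: at a standard index the entry is in [J], and below a
         nonstandard index some entry fails, which contradicts [IH]. *)
      destruct (classic (std j)) as [Sj|Sj].
      * destruct (entry_total HM s0 w j Hl0) as [y Ey]. exists y. split; auto.
        left. exists j; auto.
      * destruct (Hfail j Sj) as [k [Hk Nk]]; [apply lt_succ_iff; auto|].
        destruct (Nk (IH k Hk)).
Qed.

End Generic.

(** * Independence *)

Definition nat_structure : structure :=
  {| dom := nat; zero := 0; succ := S; add := Nat.add; mul := Nat.mul |}.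

Lemma nat_pa_model : pa_model nat_structure.
Proof.
  split; cbn; try lia.
  intros X _ H0 HS x. induction x; auto.
Qed.

Fixpoint numeral (n : nat) : tm :=
  match n with 0 => Zero | S n => Succ (numeral n) end.

Lemma eval_numeral (M : structure) (r : nat -> M) (n : nat) :
  eval r (numeral n) = Nat.iter n succ zero.
Proof. induction n; simpl; congruence. Qed.

Lemma eval_numeral_nat (r : nat -> nat) (n : nat) :
  @eval nat_structure r (numeral n) = n.
Proof. induction n; cbn in *; congruence. Qed.

Lemma bound_PA (p : fm) : PA p -> bound p = 0.
Proof. intros []; try reflexivity. apply bound_closure. Qed.

(** Compactness: [Var 0] is required to differ from every numeral. A finite set of these axioms
    mentions only numerals below some [k], and holds in the standard model when [Var 0] is [k]. *)
Lemma countable_nonstandard_model :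
  exists M : structure, pa_model M /\ countable M /\ exists w : M, ~ std w.
Proof.
  set (above := fun p => exists n, p = Not (Eq (Var 0) (numeral n))).
  destruct (model_existence (union PA above) 1) as [M [T [r [Hc H]]]].
  - assert (Hn : forall n, bound_tm (numeral n) = 0) by (induction n; auto).
    intros p [Hp|[n ->]]; [rewrite bound_PA; auto|]. simpl. rewrite Hn. auto.
  - intros [G [HG Hp]].
    assert (exists k : nat, forall n, In (Not (Eq (Var 0) (numeral n))) G -> n < k) as [k Hk].
    { clear. induction G as [|p G [k IH]]; [exists 0; intros n []|].
      destruct (classic (exists n, p = Not (Eq (Var 0) (numeral n)))) as [[m ->]|Np].
      - exists (Nat.max k (S m)). intros n [E|Hn]; [|apply IH in Hn; lia].
        injection E as E.
        assert (n = m); [|lia].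
        apply (f_equal (@eval nat_structure (fun _ => 0))) in E.
        rewrite !eval_numeral_nat in E. auto.
      - exists k. intros n [E|Hn]; auto. destruct Np; eauto. }
    apply (soundness (M := nat_structure) (fun _ => False) G Fal Hp (fun _ => k)).
    intros q Hq. destruct (HG q Hq) as [Pq|[n ->]].
    + apply sat_of_pa_model; auto. apply nat_pa_model.
    + cbn [sat Not]. rewrite eval_numeral_nat. apply Hk in Hq. cbn. lia.
  - exists M. split; [|split; auto].
    + apply pa_model_of_sat with T. intros q r' Pq.
      eapply sat_closed; [apply bound_PA, Pq|]. apply H. left; auto.
    + exists (r 0). intros [n E]. apply (H (Not (Eq (Var 0) (numeral n)))).
      * right. exists n; auto.
      * cbn. rewrite eval_numeral. exact E.
Qed.

Lemma sat_of_proves (M : structure) (T : M -> Prop) (Th : theory) (p : fm) :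
  proves Th p -> (forall q r, Th q -> sat T r q) -> forall r, sat T r p.
Proof. intros [G [HG Hp]] H r. eapply soundness; eauto. Qed.

Theorem theorem3p12 :
  proves (union PA IDelta0T) SeqOInd /\
  proves (union PA (axiom SeqOInd)) SeqInd /\
  ~ (forall p, IDelta0T p -> proves (union PA (axiom SeqOInd)) p) /\
  ~ proves (union PA (axiom SeqInd)) SeqOInd.
Proof.
  destruct countable_nonstandard_model as [M [HM [Hc [w Hw]]]].
  split; [|split; [|split]].
  - apply completeness; [|reflexivity|].
    + intros q [Pq|[p [_ ->]]]; [apply bound_PA; auto|apply bound_closure].
    + intros N T H. apply IDelta0T_SeqOInd.
      * apply pa_model_of_sat with T. intros; apply H; left; auto.
      * intros; apply H; right; auto.
  - apply completeness; [|reflexivity|].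
    + intros q [Pq| ->]; [apply bound_PA; auto|reflexivity].
    + intros N T H r. apply SeqOInd_SeqInd.
      * apply pa_model_of_sat with T. intros; apply H; left; auto.
      * apply H; right; reflexivity.
  - intros H. destruct (SeqOInd_without_IDelta0T HM Hc w Hw) as [T [HO [[x Tx] Hdesc]]].
    (* The first [Var 0] is the bound, the second the quantified variable: [T] has nothing below the
       bound. This is inductive because [T] has no least element, but it fails at [succ x]. *)
    set (p := AllLt (Var 0) (Not (Tr (Var 0)))).
    assert (Hp : forall r y, sat T (scons y r) p <-> forall z, lt z y -> ~ T z).
    { intros r y. unfold p. rewrite sat_AllLt. reflexivity. }
    assert (HI : sat T (fun _ => zero) (induction p)).
    { apply sat_of_proves with (union PA (axiom SeqOInd)).
      - apply H. exists p. split; auto. repeat constructor.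
      - intros q r [Pq| ->]; [apply sat_of_pa_model; auto|apply HO]. }
    rewrite sat_induction in HI. specialize (HI (fun _ => zero)).
    apply (proj1 (Hp (fun _ => zero) (succ x))) with x; auto.
    + apply HI.
      * apply Hp. intros z Hz. destruct (not_lt_0 HM z Hz).
      * intros y. rewrite !Hp. intros IH z Hz.
        apply (lt_succ_iff HM) in Hz as [Hz| ->]; auto. intros Ty.
        destruct (Hdesc y Ty) as [z [Hz Tz]]. exact (IH z Hz Tz).
    + apply lt_succ_diag; auto.
  - intros H. destruct (SeqInd_without_SeqOInd HM Hc w Hw) as [T [HI HO]].
    apply (HO (fun _ => zero)). apply sat_of_proves with (union PA (axiom SeqInd)); auto.
    intros q r [Pq| ->]; [apply sat_of_pa_model; auto|apply HI].
Qed.
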